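(* Let $F:\mathcal{S}_n\to\mathbb{R}$ be of class $C^2$, quasiconcave, with $F(0)=0$, and uniformly elliptic in the sense that $\lambda|\xi|^2\leq F_{ij}(M)\xi_i\xi_j\leq\Lambda|\xi|^2$ for all $M\in\mathcal{S}_n$, $\xi\in\mathbb{R}^n$, where $0<\lambda\leq\Lambda$. Let $u\in C^2(B_1)$ satisfy $F(D^2u)=0$ in $B_1\subset\mathbb{R}^n$. Then \[ \|u\|_{C^{2,\alpha}(\overline{B}_{1/2})}\leq C, \] where $\alpha\in(0,1)$ depends only on $n,\lambda,\Lambda$, and $C$ depends on $n,\lambda,\Lambda$ and also on $\|u\|_{C^{1,1}(\overline{B}_{3/4})}$.
   Context: $\mathcal{S}_n$ denotes the space of real symmetric $n\times n$ matrices; $F_{ij}(M)=\partial F(M)/\partial m_{ij}$, with summation over repeated indices. $F$ is quasiconcave if all its superlevel sets $\{M\in\mathcal{S}_n: F(M)\geq a\}$, $a\in\mathbb{R}$, are convex, equivalently $F(\theta M_1+(1-\theta)M_2)\geq\min\{F(M_1),F(M_2)\}$ for all $M_1,M_2\in\mathcal{S}_n$, $\theta\in[0,1]$. $B_r$ is the ball of radius $r$ centered at $0$. *)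

(* Defs.v *)
From HB Require Import structures.
From mathcomp Require Import all_boot all_order all_algebra.
From mathcomp Require Import all_classical all_reals all_analysis.
Set Implicit Arguments. Unset Strict Implicit. Unset Printing Implicit Defensive.
Import Order.TTheory GRing.Theory Num.Theory.
Import numFieldNormedType.Exports.
Local Open Scope classical_set_scope.
Local Open Scope ring_scope.

Section Defs.
Variable R : realType.

Definition pd (p q : nat) (f : 'M[R]_(p, q) -> R) (i : 'I_p) (j : 'I_q)
  : 'M[R]_(p, q) -> R := fun x => 'D_(delta_mx i j) f x.

Definition C2_on (p q : nat) (U : set 'M[R]_(p, q)) (f : 'M[R]_(p, q) -> R) :=
  [/\ (forall x, U x -> differentiable f x),
      (forall i j x, U x -> differentiable (pd f i j) x) &
      (forall i j k l, {within U, continuous (pd (pd f i j) k l)})].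

Definition enorm2 (n : nat) (x : 'rV[R]_n) : R := \sum_i (x ord0 i) ^+ 2.
Definition enorm (n : nat) (x : 'rV[R]_n) : R := Num.sqrt (enorm2 x).
Definition eball (n : nat) (r : R) : set 'rV[R]_n := [set x | enorm x < r].
Definition cball (n : nat) (r : R) : set 'rV[R]_n := [set x | enorm x <= r].

Definition du (n : nat) (u : 'rV[R]_n -> R) (i : 'I_n) := pd u ord0 i.
Definition ddu (n : nat) (u : 'rV[R]_n -> R) (i j : 'I_n) := du (du u j) i.
Definition hess (n : nat) (u : 'rV[R]_n -> R) (x : 'rV[R]_n) : 'M[R]_n :=
  \matrix_(i, j) ddu u i j x.

Definition symmetric_mx (n : nat) (M : 'M[R]_n) := M^T = M.

(* the extension of F : S_n -> R to all matrices through the symmetric part;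
   F|S_n is C^k iff symmetrize F is C^k on 'M_n, and
   pd (symmetrize F) i j = F_ij with the usual symmetric convention *)
Definition symmetrize (n : nat) (F : 'M[R]_n -> R) : 'M[R]_n -> R :=
  fun M => F ((2%:R)^-1 *: (M + M^T)).

Definition quasiconcave (n : nat) (F : 'M[R]_n -> R) :=
  forall M1 M2 : 'M[R]_n, symmetric_mx M1 -> symmetric_mx M2 ->
  forall t : R, 0 <= t <= 1 ->
    Num.min (F M1) (F M2) <= F (t *: M1 + (1 - t) *: M2).

Definition unif_elliptic (n : nat) (lam Lam : R) (F : 'M[R]_n -> R) :=
  forall (M : 'M[R]_n) (xi : 'rV[R]_n), symmetric_mx M ->
    let q := \sum_i \sum_j pd (symmetrize F) i j M * xi ord0 i * xi ord0 j in
    lam * enorm2 xi <= q /\ q <= Lam * enorm2 xi.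

Definition C11_bound (n : nat) (u : 'rV[R]_n -> R) (A : set 'rV[R]_n) (K : R) :=
  [/\ (forall x, A x -> `|u x| <= K),
      (forall i x, A x -> `|du u i x| <= K) &
      (forall i x y, A x -> A y -> `|du u i x - du u i y| <= K * enorm (x - y))].

Definition C2alpha_bound (n : nat) (u : 'rV[R]_n -> R) (A : set 'rV[R]_n)
    (alpha C : R) :=
  [/\ (forall x, A x -> `|u x| <= C),
      (forall i x, A x -> `|du u i x| <= C),
      (forall i j x, A x -> `|ddu u i j x| <= C) &
      (forall i j x y, A x -> A y ->
         `|ddu u i j x - ddu u i j y| <= C * powR (enorm (x - y)) alpha)].

End Defs.

(* Main.v *)
(** Write [H] for the Hessian of [u] and [A x] for the gradient of [F] at
    [H x]. Quasiconcavity makes {F >= 0} convex, hence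
    [<A x, H y - H x> >= 0] for all [x], [y]; in particular every second
    difference quotient [v] of [u] satisfies [<A x, D^2 v> >= 0], a linear
    elliptic inequality with no control on the modulus of continuity of [A].

    The Krylov-Safonov weak Harnack inequality for such [v] is proved without
    Lebesgue measure: the size of a set is the proportion of small dyadic cells
    that it meets. Slopes are taken in a finite grid, each slope gives a contact
    point of [v] minus a polynomial barrier, a cell contains boundedly many
    contact points, and the Calderon-Zygmund lemma is an induction on the
    dyadic tree.

    Colour the Hessian values with finitely many colours. Some colour is
    popular; as long as the oscillation of [H] is not small, ellipticity gives a
    direction [e] in which the popular values lie well below the maximum of
    [u_ee], so by weak Harnack the values near this maximum disappear from a
    smaller cube. A colour is lost at each step, so after a bounded number of
    steps the oscillation has halved, and iteration gives the Holder bound. *)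
Require Import Defs.
From HB Require Import structures.
From mathcomp Require Import all_boot all_order all_algebra.
From mathcomp Require Import all_classical all_reals all_analysis.
From mathcomp Require Import ring lra zify.
Set Implicit Arguments. Unset Strict Implicit. Unset Printing Implicit Defensive.
Import Order.TTheory GRing.Theory Num.Theory.
Import numFieldNormedType.Exports.
Local Open Scope classical_set_scope.
Local Open Scope ring_scope.


(** * Quadratic forms, positive semidefinite matrices and ellipticity *)

Section LinearAlgebra.
Variables (R : realType) (n : nat).
Implicit Types (A N P : 'M[R]_n) (x y z : 'rV[R]_n).

(** The obstacle is uniformity: [u] is merely of class $C^2$, with a modulus of continuity that no
    constant may see. Two scales are taken from [u] itself after all constants are fixed, the step
    of the difference quotient and the generation of the smallest dyadic cells; the density
    estimates hold with the same fraction at every generation. A difference quotient is used because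
    $u_{ee}$ is only continuous, whereas the quotient has a second-order expansion whose matrix is a
    sum of differences [H (x + he) - H x] and [H (x - he) - H x], on which the normal at [x] has a
    sign.

    Counting replaces the area formula. On a cube of half-side $h$ with cells of half-side $\eta$,
    slopes are spaced by $t\eta/h^2$. At a contact point the function is touched from above by a
    paraboloid of opening of order $t/h^2$, so two contact points in one cell have slopes a bounded
    number of grid steps apart, and a fixed fraction of all cells is hit.

    Cubes are sup-norm balls, which subdivide exactly, while barriers are radial in the Euclidean
    norm; passing between the two norms produces the powers of [n] in the constants. *)

Definition dot x y : R := \sum_i x ord0 i * y ord0 i.
Definition ip A N : R := \sum_i \sum_j A i j * N i j.
Definition qf A z : R := \sum_i \sum_j A i j * z ord0 i * z ord0 j.
Definition elliptic (lam Lam : R) A :=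
  forall z, lam * enorm2 z <= qf A z /\ qf A z <= Lam * enorm2 z.
Definition psd P := P^T = P /\ forall z, 0 <= qf P z.

Lemma dotC x y : dot x y = dot y x.
Proof. by apply: eq_bigr => i _; rewrite mulrC. Qed.

Lemma dotDl x y z : dot (x + y) z = dot x z + dot y z.
Proof. by rewrite -big_split; apply: eq_bigr => i _; rewrite mxE mulrDl. Qed.

Lemma dotZl (a : R) x y : dot (a *: x) y = a * dot x y.
Proof. by rewrite mulr_sumr; apply: eq_bigr => i _; rewrite mxE mulrA. Qed.

Lemma dotNl x y : dot (- x) y = - dot x y.
Proof. by rewrite -scaleN1r dotZl mulN1r. Qed.

Lemma dotDr x y z : dot z (x + y) = dot z x + dot z y.
Proof. by rewrite !(dotC z) dotDl. Qed.

Lemma dotZr (a : R) x y : dot y (a *: x) = a * dot y x.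
Proof. by rewrite !(dotC y) dotZl. Qed.

Lemma dotNr x y : dot y (- x) = - dot y x.
Proof. by rewrite !(dotC y) dotNl. Qed.

Lemma dot_delta x i : dot x (delta_mx ord0 i) = x ord0 i.
Proof.
rewrite /dot (bigD1 i) //= mxE !eqxx mulr1 big1 ?addr0 // => j ji.
by rewrite mxE (negbTE ji) andbF mulr0.
Qed.

Lemma enorm2E x : enorm2 x = dot x x.
Proof. by apply: eq_bigr => i _; rewrite expr2. Qed.

Lemma enorm2_ge0 x : 0 <= enorm2 x.
Proof. by apply: sumr_ge0 => i _; exact: sqr_ge0. Qed.

Lemma enorm2Z (a : R) x : enorm2 (a *: x) = a ^+ 2 * enorm2 x.
Proof. by rewrite !enorm2E dotZl dotZr mulrA expr2. Qed.

Lemma enorm2N x : enorm2 (- x) = enorm2 x.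
Proof. by rewrite !enorm2E dotNl dotNr opprK. Qed.

Lemma enorm2D x y : enorm2 (x + y) = enorm2 x + 2 * dot x y + enorm2 y.
Proof. rewrite !enorm2E !dotDl !dotDr (dotC y x); ring. Qed.

Lemma enorm2_delta i : enorm2 (delta_mx ord0 i : 'rV[R]_n) = 1.
Proof. by rewrite enorm2E dot_delta mxE !eqxx. Qed.

Lemma coord_sqr_le_enorm2 x i : x ord0 i ^+ 2 <= enorm2 x.
Proof.
rewrite /enorm2 (bigD1 i) //= lerDl; apply: sumr_ge0 => j _; exact: sqr_ge0.
Qed.

Lemma enorm2_le_coord x (a : R) :
  (forall i, `|x ord0 i| <= a) -> enorm2 x <= n%:R * a ^+ 2.
Proof.
move=> xa; have -> : n%:R * a ^+ 2 = \sum_(i < n) a ^+ 2.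
  by rewrite sumr_const card_ord mulr_natl.
apply: ler_sum => i _; rewrite -[x ord0 i ^+ 2]real_normK ?num_real//.
by rewrite lerXn2r ?nnegrE// (le_trans _ (xa i)).
Qed.

Lemma cauchy_schwarz x y : dot x y ^+ 2 <= enorm2 x * enorm2 y.
Proof.
have H (t : R) : 0 <= enorm2 x + 2 * (t * dot x y) + t ^+ 2 * enorm2 y.
  by have := enorm2_ge0 (x + t *: y); rewrite enorm2D dotZr enorm2Z.
have [y0|y0] := eqVneq (enorm2 y) 0.
  rewrite y0 mulr0; have [->|d0] := eqVneq (dot x y) 0; first by rewrite expr0n.
  have := H (- (enorm2 x + 1) / (2 * dot x y)); rewrite y0 mulr0 addr0.
  have -> : 2 * (- (enorm2 x + 1) / (2 * dot x y) * dot x y) = - (enorm2 x + 1)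
    by field.
  lra.
have yp : 0 < enorm2 y by rewrite lt0r y0 enorm2_ge0.
have := H (- dot x y / enorm2 y).
have -> : enorm2 x + 2 * (- dot x y / enorm2 y * dot x y)
    + (- dot x y / enorm2 y) ^+ 2 * enorm2 y
    = (enorm2 x * enorm2 y - dot x y ^+ 2) / enorm2 y by field.
by rewrite pmulr_lge0 ?invr_gt0// subr_ge0.
Qed.

Lemma ipDr A N P : ip A (N + P) = ip A N + ip A P.
Proof.
rewrite -big_split; apply: eq_bigr => i _; rewrite -big_split.
by apply: eq_bigr => j _; rewrite mxE mulrDr.
Qed.

Lemma ipZr A (a : R) N : ip A (a *: N) = a * ip A N.
Proof.
rewrite mulr_sumr; apply: eq_bigr => i _; rewrite mulr_sumr.
by apply: eq_bigr => j _; rewrite mxE; ring.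
Qed.

Lemma ipNr A N : ip A (- N) = - ip A N.
Proof. by rewrite -scaleN1r ipZr mulN1r. Qed.

Lemma ipBr A N P : ip A (N - P) = ip A N - ip A P.
Proof. by rewrite ipDr ipNr. Qed.

Lemma ip_sumr A (I : Type) (s : seq I) (f : I -> 'M[R]_n) :
  ip A (\sum_(k <- s) f k) = \sum_(k <- s) ip A (f k).
Proof.
elim: s => [|k s IH]; last by rewrite !big_cons ipDr IH.
by rewrite !big_nil /ip; do 2 (apply: big1 => ? _); rewrite mxE mulr0.
Qed.

Lemma outerE x i j : (x^T *m x) i j = x ord0 i * x ord0 j.
Proof. by rewrite mxE big_ord1 mxE. Qed.

Lemma ip_outer A x : ip A (x^T *m x) = qf A x.
Proof.
by apply: eq_bigr => i _; apply: eq_bigr => j _; rewrite outerE mulrA.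
Qed.

Lemma ip_scalar A (a : R) : ip A a%:M = a * \tr A.
Proof.
rewrite /mxtrace mulr_sumr; apply: eq_bigr => i _.
rewrite (bigD1 i) //= mxE eqxx mulr1n big1 ?addr0 1?mulrC // => j ji.
by rewrite mxE eq_sym (negbTE ji) mulr0n mulr0.
Qed.

Lemma qfD A N z : qf (A + N) z = qf A z + qf N z.
Proof.
rewrite -big_split; apply: eq_bigr => i _; rewrite -big_split.
by apply: eq_bigr => j _; rewrite mxE !mulrDl.
Qed.

Lemma qfZ (a : R) A z : qf (a *: A) z = a * qf A z.
Proof.
rewrite mulr_sumr; apply: eq_bigr => i _; rewrite mulr_sumr.
by apply: eq_bigr => j _; rewrite mxE; ring.
Qed.

Lemma qfN A z : qf (- A) z = - qf A z.
Proof. by rewrite -scaleN1r qfZ mulN1r. Qed.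

Lemma qfB A N z : qf (A - N) z = qf A z - qf N z.
Proof. by rewrite qfD qfN. Qed.

Lemma qfZv (a : R) A z : qf A (a *: z) = a ^+ 2 * qf A z.
Proof.
rewrite mulr_sumr; apply: eq_bigr => i _; rewrite mulr_sumr.
by apply: eq_bigr => j _; rewrite !mxE; ring.
Qed.

Lemma qf_outer x z : qf (x^T *m x) z = dot x z ^+ 2.
Proof.
rewrite expr2 /dot mulr_suml; apply: eq_bigr => i _; rewrite mulr_sumr.
by apply: eq_bigr => j _; rewrite outerE; ring.
Qed.

Lemma qf_scalar (a : R) z : qf a%:M z = a * enorm2 z.
Proof.
rewrite /enorm2 mulr_sumr; apply: eq_bigr => i _.
rewrite (bigD1 i) //= mxE eqxx mulr1n big1 ?addr0 => [|j ji].
  by rewrite expr2 mulrA.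
by rewrite mxE eq_sym (negbTE ji) mulr0n !mul0r.
Qed.

Lemma qf_sumr (I : Type) (s : seq I) (f : I -> 'M[R]_n) z :
  qf (\sum_(k <- s) f k) z = \sum_(k <- s) qf (f k) z.
Proof.
elim: s => [|k s IH]; last by rewrite !big_cons qfD IH.
by rewrite !big_nil /qf; do 2 (apply: big1 => ? _); rewrite mxE !mul0r.
Qed.

Lemma qf_delta A i : qf A (delta_mx ord0 i) = A i i.
Proof.
rewrite /qf (bigD1 i) //= [X in _ + X]big1 ?addr0 => [|j ji]; last first.
  by apply: big1 => k _; rewrite [delta_mx _ _ _ j]mxE (negbTE ji) andbF mulr0 mul0r.
rewrite (bigD1 i) //= big1 ?addr0 => [|k ki].
  by rewrite mxE !eqxx !mulr1.
by rewrite !mxE (negbTE ki) andbF mulr0.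
Qed.

(** As a quadratic polynomial in [t] this exposes the pivot [A i i]; its discriminant controls row
    [i] in the elimination below. *)
Lemma qf_shift A z i (t : R) : A^T = A ->
  qf A (z + t *: delta_mx ord0 i)
  = qf A z + 2 * t * dot (row i A) z + t ^+ 2 * A i i.
Proof.
move=> As; have AE k l : A k l = A l k by rewrite -{1}As mxE.
pose e : 'rV[R]_n := delta_mx ord0 i.
have bil x y : qf A (x + y) = qf A x + 2 * dot (x *m A) y + qf A y.
  have qfE v : qf A v = dot (v *m A) v.
    rewrite /dot /qf exchange_big /=; apply: eq_bigr => k _.
    by rewrite mxE mulr_suml; apply: eq_bigr => l _; rewrite (mulrC (v _ _)).
  have sym : dot (y *m A) x = dot (x *m A) y.
    rewrite /dot; under eq_bigr do rewrite mxE mulr_suml.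
    rewrite exchange_big /=; apply: eq_bigr => k _; rewrite mxE mulr_suml.
    by apply: eq_bigr => l _; rewrite (AE k l); ring.
  by rewrite !qfE mulmxDl !dotDl !dotDr sym; ring.
rewrite bil qfZv qf_delta -/e dotZr.
suff -> : dot (z *m A) e = dot (row i A) z by ring.
rewrite dot_delta mxE dotC; apply: eq_bigr => k _.
by rewrite mxE AE.
Qed.

(* Gaussian elimination: subtracting [row_i^T row_i / P_ii] kills row [i]
   and keeps the matrix positive semidefinite. *)
Lemma psd_sum_outer P : psd P ->
  exists s : seq 'rV[R]_n, P = \sum_(x <- s) x^T *m x.
Proof.
have [k] := ubnP #|[pred i | P i i != 0]|; elim: k P => // k IH P kP [Ps Pp].
have PE i j : P i j = P j i by rewrite -{1}Ps mxE.
have diag i : 0 <= P i i by rewrite -qf_delta.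
(* Cauchy-Schwarz for the form of [P]: the polynomial of [qf_shift] is evaluated at its minimum. For
   a zero pivot it is affine in [t], and a nonzero slope would make it negative somewhere. *)
have key i (z : 'rV[R]_n) : dot (row i P) z ^+ 2 <= P i i * qf P z.
  have [p0|p0] := eqVneq (P i i) 0.
    rewrite p0 mul0r; have [->|d0] := eqVneq (dot (row i P) z) 0; first by rewrite expr0n.
    have := Pp (z + (- (qf P z + 1) / (2 * dot (row i P) z)) *: delta_mx ord0 i).
    rewrite qf_shift// p0 mulr0 addr0.
    have -> : 2 * (- (qf P z + 1) / (2 * dot (row i P) z)) * dot (row i P) z
      = - (qf P z + 1) by field.
    lra.
  have pp : 0 < P i i by rewrite lt0r p0 diag.
  have := Pp (z + (- dot (row i P) z / P i i) *: delta_mx ord0 i).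
  rewrite qf_shift//.
  have -> : qf P z + 2 * (- dot (row i P) z / P i i) * dot (row i P) z +
     (- dot (row i P) z / P i i) ^+ 2 * P i i
     = (P i i * qf P z - dot (row i P) z ^+ 2) / P i i by field.
  by rewrite pmulr_lge0 ?invr_gt0// subr_ge0.
have offdiag i j : P i j ^+ 2 <= P i i * P j j.
  by have := key i (delta_mx ord0 j); rewrite dot_delta mxE qf_delta.
have [i /= Pii|noi] := pickP [pred i | P i i != 0]; last first.
  exists [::]; rewrite big_nil; apply/matrixP => i j; rewrite mxE.
  have := offdiag i j; have /eqP-> := negbFE (noi i); rewrite mul0r => H.
  by apply/eqP; rewrite -sqrf_eq0 eq_le H sqr_ge0.
have pp : 0 < P i i by rewrite lt0r Pii diag.
pose v := (Num.sqrt (P i i))^-1 *: row i P.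
have vE a b : (v^T *m v) a b = P i a * P i b / P i i.
  rewrite outerE !mxE mulrACA -expr2 exprVn sqr_sqrtr ?diag//.
  by rewrite mulrC.
have [s Es] : exists s : seq 'rV[R]_n, P - v^T *m v = \sum_(x <- s) x^T *m x.
  apply: IH; last first.
    split; first by rewrite raddfB /= trmx_mul trmxK Ps.
    move=> z; rewrite qfB qf_outer dotZl exprMn exprVn sqr_sqrtr ?diag//.
    by rewrite subr_ge0 ler_pdivrMl// key.
  (* The number of nonzero diagonal entries drops: entry [i] is cancelled, and a zero diagonal entry
     stays zero by [offdiag]. *)
  rewrite ltnS in kP; apply: leq_trans kP.
  apply: proper_card; apply/properP; split; last first.
    exists i; rewrite inE//= !mxE.
    have := vE i i; rewrite mxE => ->; rewrite negbK.
    by rewrite mulfK ?subrr.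
  apply/fintype.subsetP => a; rewrite !inE; apply: contra => /eqP a0.
  rewrite mxE [X in _ + X]mxE vE a0 sub0r oppr_eq0 mulf_eq0; apply/orP; left.
  by rewrite -expr2 sqrf_eq0 -sqrf_eq0 eq_le sqr_ge0 andbT; have := offdiag i a; rewrite a0 mulr0.
by exists (v :: s); rewrite big_cons -Es addrC subrK.
Qed.

Lemma trace_outer x : \tr (x^T *m x) = enorm2 x.
Proof. by apply: eq_bigr => i _; rewrite outerE expr2. Qed.

(** Both sides are additive, so [psd_sum_outer] reduces the claim to rank-one matrices, where it is
    ellipticity itself. *)
Lemma elliptic_ip_psd (lam Lam : R) A P : elliptic lam Lam A -> psd P ->
  lam * \tr P <= ip A P.
Proof.
move=> eA /psd_sum_outer[s ->]; rewrite ip_sumr raddf_sum mulr_sumr /=.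
by apply: ler_sum => x _; rewrite ip_outer trace_outer; have [] := eA x.
Qed.

Lemma psd_trace_ge0 P : psd P -> 0 <= \tr P.
Proof. by move=> [_ Pp]; apply: sumr_ge0 => i _; rewrite -qf_delta. Qed.

Lemma psd_qf_le P z : psd P -> qf P z <= \tr P * enorm2 z.
Proof.
move=> /psd_sum_outer[s ->]; rewrite qf_sumr raddf_sum mulr_suml /=.
by apply: ler_sum => x _; rewrite qf_outer trace_outer cauchy_schwarz.
Qed.

Lemma psd_entry_le P i j : psd P -> `|P i j| <= \tr P.
Proof.
move=> /psd_sum_outer[s ->]; rewrite raddf_sum /= summxE.
apply: le_trans (ler_norm_sum _ _ _) _; apply: ler_sum => x _.
rewrite outerE trace_outer.
have a := coord_sqr_le_enorm2 x i; have b := coord_sqr_le_enorm2 x j.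
rewrite ler_norml; apply/andP; split.
  by have := sqr_ge0 (x ord0 i + x ord0 j); nra.
by have := sqr_ge0 (x ord0 i - x ord0 j); nra.
Qed.

Lemma trace_le_elliptic (lam Lam : R) A : elliptic lam Lam A ->
  lam * n%:R <= \tr A /\ \tr A <= n%:R * Lam.
Proof.
move=> eA; have d i : lam <= A i i /\ A i i <= Lam.
  by have := eA (delta_mx ord0 i); rewrite qf_delta enorm2_delta !mulr1.
have E a : n%:R * a = \sum_(i < n) a :> R by rewrite sumr_const card_ord mulr_natl.
by rewrite (mulrC lam) !E; split; apply: ler_sum => i _; have [] := d i.
Qed.

(* If [qf N] were small on the whole unit sphere then [c I - N] would be
   positive semidefinite of small trace, hence [N] itself small. *)
Lemma elliptic_positive_direction (lam Lam : R) A N (c : R) i j :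
  0 < lam -> elliptic lam Lam A -> N^T = N -> 0 <= ip A N -> 0 < c ->
  c * (1 + n%:R * Lam / lam) < `|N i j| ->
  exists e : 'rV[R]_n, enorm2 e = 1 /\ c <= qf N e.
Proof.
move=> l0 eA Ns AN c0 Nij; apply: contrapT => noe.
have qN z : qf N z <= c * enorm2 z.
  have [z0|z0] := eqVneq (enorm2 z) 0.
    have zz : z = 0.
      apply/rowP => k; rewrite mxE; apply/eqP; rewrite -sqrf_eq0 eq_le sqr_ge0.
      by rewrite andbT -z0 coord_sqr_le_enorm2.
    by rewrite z0 mulr0 zz -(scale0r 0) qfZv expr0n mul0r.
  have zp : 0 < enorm2 z by rewrite lt0r z0 enorm2_ge0.
  rewrite leNgt; apply/negP => H; apply: noe.
  exists ((Num.sqrt (enorm2 z))^-1 *: z).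
  rewrite enorm2Z qfZv exprVn sqr_sqrtr ?enorm2_ge0// mulVf ?gt_eqF//; split=> //.
  by rewrite ler_pdivlMl// mulrC ltW.
have P : psd (c%:M - N).
  split; first by rewrite raddfB /= tr_scalar_mx Ns.
  by move=> z; rewrite qfB qf_scalar subr_ge0.
have := elliptic_ip_psd eA P; rewrite ipBr ip_scalar => H.
have [_ tA] := trace_le_elliptic eA.
have trP : \tr (c%:M - N) <= c * (n%:R * Lam) / lam.
  rewrite ler_pdivlMr// mulrC; apply: le_trans H _.
  by rewrite lerBlDr; have := ler_wpM2l (ltW c0) tA; lra.
have := psd_entry_le i j P; rewrite !mxE => Pij.
move: Nij; apply/negP; rewrite -leNgt.
have : `|N i j| <= `|c *+ (i == j)| + `|c *+ (i == j) - N i j|.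
  have {1}-> : N i j = c *+ (i == j) - (c *+ (i == j) - N i j) by ring.
  exact: ler_normB.
have : `|c *+ (i == j)| <= c.
  by case: (i == j); rewrite ?mulr1n ?mulr0n ?normr0 ?(ltW c0) ?(gtr0_norm c0).
have -> : c * (1 + n%:R * Lam / lam) = c + c * (n%:R * Lam) / lam by ring.
lra.
Qed.

Lemma qf_le_entries N (a : R) z : (forall i j, `|N i j| <= a) ->
  `|qf N z| <= a * n%:R * enorm2 z.
Proof.
move=> Na; apply: le_trans (ler_norm_sum _ _ _) _.
have H i j : `|N i j * z ord0 i * z ord0 j| <= a * ((z ord0 i ^+ 2 + z ord0 j ^+ 2) / 2).
  rewrite -mulrA normrM; apply: ler_pM => //.
  rewrite ler_norml; apply/andP; split.
    by have := sqr_ge0 (z ord0 i + z ord0 j); nra.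
  by have := sqr_ge0 (z ord0 i - z ord0 j); nra.
apply: le_trans (_ : \sum_i \sum_j a * ((z ord0 i ^+ 2 + z ord0 j ^+ 2) / 2) <= _).
  apply: ler_sum => i _; apply: le_trans (ler_norm_sum _ _ _) _.
  by apply: ler_sum => j _; exact: H.
have E1 : \sum_(i < n) \sum_(j < n) z ord0 i ^+ 2 = n%:R * enorm2 z.
  rewrite exchange_big /= sumr_const card_ord mulr_natl //.
have E2 : \sum_(i < n) \sum_(j < n) z ord0 j ^+ 2 = n%:R * enorm2 z.
  by rewrite sumr_const card_ord mulr_natl.
have -> : \sum_(i < n) \sum_(j < n) a * ((z ord0 i ^+ 2 + z ord0 j ^+ 2) / 2)
  = a / 2 * (\sum_(i < n) \sum_(j < n) z ord0 i ^+ 2 + \sum_(i < n) \sum_(j < n) z ord0 j ^+ 2).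
  rewrite -big_split mulr_sumr; apply: eq_bigr => i _; rewrite -big_split mulr_sumr.
  by apply: eq_bigr => j _ /=; ring.
by rewrite E1 E2 le_eqVlt; apply/orP; left; apply/eqP; field.
Qed.

End LinearAlgebra.


(** * Norm comparison, compactness and uniform continuity *)

Section Compactness.
Variables (R : realType) (n : nat).
Implicit Types (x y z : 'rV[R]_n) (S : set 'rV[R]_n).

Lemma coord_le_norm x i : `|x ord0 i| <= `|x|.
Proof.
rewrite [leRHS]/Num.Def.normr /= mx_normrE; apply/bigmax_geP; right => /=.
by exists (ord0, i).
Qed.

Lemma norm_le_coord x (a : R) :
  0 <= a -> (forall i, `|x ord0 i| <= a) -> `|x| <= a.
Proof.
move=> a0 xa; rewrite [leLHS]/Num.Def.normr /= mx_normrE; apply/bigmax_leP; split=> //.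
by move=> [i j] _ /=; rewrite ord1.
Qed.

Lemma norm_sqr_le_enorm2 x : `|x| ^+ 2 <= enorm2 x.
Proof.
have e0 := enorm2_ge0 x.
rewrite -[leRHS]sqr_sqrtr// lerXn2r ?nnegrE ?sqrtr_ge0//.
apply: norm_le_coord; first exact: sqrtr_ge0.
move=> i; rewrite -[leLHS]ger0_norm// -sqrtr_sqr ler_wsqrtr//.
by rewrite real_normK ?num_real// coord_sqr_le_enorm2.
Qed.

Lemma enorm2_le_norm x : enorm2 x <= n%:R * `|x| ^+ 2.
Proof. by apply: enorm2_le_coord => i; exact: coord_le_norm. Qed.

Lemma continuous_sum (I : Type) (s : seq I) (f : I -> 'rV[R]_n -> R) :
  (forall i, continuous (f i)) -> continuous (fun x => \sum_(i <- s) f i x).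
Proof.
move=> cf; elim: s => [|i s IH].
  under eq_fun do rewrite big_nil; exact: cst_continuous.
under eq_fun do rewrite big_cons; move=> x.
have := @continuousD _ _ _ (f i) (fun x => \sum_(i <- s) f i x) x (cf i x) (IH x); exact.
Qed.

Lemma enorm2_continuous : continuous (@enorm2 R n).
Proof.
apply: continuous_sum => i x.
exact: (@continuous_comp _ _ _ (fun x : 'rV[R]_n => x ord0 i) (fun y : R => y ^+ 2) x
  (@coord_continuous R 1 n ord0 i x) (@exprn_continuous R 2 _)).
Qed.

Lemma dot_continuous (p : 'rV[R]_n) : continuous (dot p).
Proof.
apply: continuous_sum => i x.
exact: (@continuousM _ _ (cst (p ord0 i)) (fun x : 'rV[R]_n => x ord0 i) x
  (@cst_continuous _ _ _ x) (@coord_continuous R 1 n ord0 i x)).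
Qed.

Lemma nbhs_mxP p q (x : 'M[R]_(p, q)) (P : set 'M[R]_(p, q)) :
  nbhs x P <-> exists d : R, 0 < d /\ forall y : 'M[R]_(p, q), `|x - y| < d -> P y.
Proof.
split=> [/nbhs_ballP[d /= d0 H]|[d [d0 H]]].
  by exists d; split=> // y xy; apply: H; rewrite mx_norm_ball.
by apply/nbhs_ballP; exists d => //= y; rewrite mx_norm_ball; exact: H.
Qed.

Definition ucont S (f : 'rV[R]_n -> R) := forall e : R, 0 < e ->
  exists d : R, 0 < d /\
  forall x y, S x -> S y -> `|x - y| <= d -> `|f x - f y| <= e.

Lemma ucont_within S f : ucont S f -> {within S, continuous f}.
Proof.
move=> uf; apply/subspace_continuousP => x Sx.
apply/cvgrPdist_le => e e0; have [d [d0 H]] := uf e e0.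
rewrite near_withinE.
suff : nbhs (x : 'rV[R]_n) [set y | S y -> `|f x - f y| <= e] by [].
by apply/nbhs_mxP; exists d; split=> // y /ltW xy Sy; exact: H.
Qed.

Lemma compact_sublevel (g : 'rV[R]_n -> R) (a b : R) : continuous g ->
  (forall x, g x <= a -> `|x| <= b) -> compact [set x | g x <= a].
Proof.
move=> cg H; apply: bounded_closed_compact.
  by exists b; split=> [|M bM x xA]; [exact: num_real|exact: le_trans (H x xA) (ltW bM)].
by apply: (@preimage_closed _ _ g [set y | y <= a]); [move=> ? _; exact: cg|exact: closed_le].
Qed.

Lemma shift_continuous (c : 'rV[R]_n) : continuous (fun x : 'rV[R]_n => x - c).
Proof. by move=> x; exact: (@continuousB _ _ _ idfun (cst c) x (@cvg_id _ _) (@cst_continuous _ _ c x)). Qed.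

Lemma compact_eball (c : 'rV[R]_n) (a : R) : compact [set x | enorm2 (x - c) <= a].
Proof.
apply: (@compact_sublevel (fun x => enorm2 (x - c)) _ (`|c| + (1 + a))) => [x|x xa].
  by apply: continuous_comp; [exact: shift_continuous|exact: enorm2_continuous].
rewrite -[x in leLHS](subrK c) addrC; apply: le_trans (ler_normD _ _) _.
rewrite lerD2l; have := le_trans (norm_sqr_le_enorm2 _) xa.
have := normr_ge0 (x - c); nra.
Qed.

Lemma compact_cube (c : 'rV[R]_n) (a : R) : compact [set x | `|x - c| <= a].
Proof.
apply: (@compact_sublevel (fun x => `|x - c|) _ (`|c| + a)) => [x|x xa].
  by apply: continuous_comp; [exact: shift_continuous|exact: norm_continuous].
rewrite -[x in leLHS](subrK c) addrC; apply: le_trans (ler_normD _ _) _.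
by rewrite lerD2l.
Qed.

(** Heine-Cantor. The covering form of compactness is used with the filter of radii tending to zero
    from the right, which turns the local radii into a common one. *)
Lemma compact_ucont S f : compact S -> (forall x, S x -> {for x, continuous f}) ->
  ucont S f.
Proof.
move=> cS cf e e0.
have e2 : 0 < e / 2 by rewrite divr_gt0.
have /(_ R (0^'+) (fun d x => forall y, `|x - y| <= d -> `|f x - f y| <= e)) :=
  proj1 (compact_near_coveringP S) cS.
case.
  move=> x Sx; have /cvgrPdist_le/(_ _ e2) := cf x Sx.
  move=> /nbhs_mxP[d [d0 H]].
  exists ([set y | `|x - y| < d / 2], [set s | s < d / 2]) => /=.
    split; first by apply/nbhs_mxP; exists (d / 2); split=> //; rewrite divr_gt0.
    by apply: nbhs_right_lt; rewrite divr_gt0.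
  move=> [y s] /= [xy sd] z yz.
  rewrite -(subrKA (f x)); apply: le_trans (ler_normD _ _) _.
  rewrite (splitr e) lerD//; first by rewrite distrC H //=; lra.
  rewrite H //= -(subrKA y); apply: le_lt_trans (ler_normD _ _) _; lra.
move=> d /= d0 H; exists (d / 2); split; first by rewrite divr_gt0.
move=> x y Sx Sy xy; apply: (H (d / 2)) => //=; last by rewrite divr_gt0.
rewrite sub0r normrN gtr0_norm ?divr_gt0//; lra.
Qed.

End Compactness.


(** * Elementary power inequalities *)

Section PowerInequalities.
Variable R : realType.
Implicit Types a s q b : R.

(** In the binomial expansion the odd powers of [s] cancel, and for [a >= 0] the even terms that are
    dropped are nonnegative. *)
Lemma second_difference_pow a s m : 0 <= a ->
  2 * a ^+ m.+2 + (m.+2 * m.+1)%:R * a ^+ m * s ^+ 2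
  <= (a + s) ^+ m.+2 + (a - s) ^+ m.+2.
Proof.
move=> a0.
(* The recursion for the sum of the two powers involves [s] times their difference, so a lower bound
   for that product is carried along. *)
suff [//] : 2 * a ^+ m.+2 + (m.+2 * m.+1)%:R * a ^+ m * s ^+ 2
    <= (a + s) ^+ m.+2 + (a - s) ^+ m.+2
  /\ 2 * m.+2%:R * a ^+ m.+1 * s ^+ 2
    <= s * ((a + s) ^+ m.+2 - (a - s) ^+ m.+2).
elim: m => [|m [IH1 IH2]].
  by split; rewrite le_eqVlt; apply/orP; left; apply/eqP; ring.
set p := (a + s) ^+ m.+2 in IH1 IH2 *; set r := (a - s) ^+ m.+2 in IH1 IH2 *.
have am : 0 <= a ^+ m by rewrite exprn_ge0.
have s2 := sqr_ge0 s.
rewrite ![_ ^+ m.+3]exprS -/p -/r; split.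
  have -> : (a + s) * p + (a - s) * r = a * (p + r) + s * (p - r) by ring.
  apply: le_trans (lerD (ler_wpM2l a0 IH1) IH2).
  by rewrite le_eqVlt; apply/orP; left; apply/eqP; rewrite !natrM -!natr1 !exprS; ring.
have -> : s * ((a + s) * p - (a - s) * r) = a * (s * (p - r)) + s ^+ 2 * (p + r) by ring.
have IH1' : 2 * a ^+ m.+2 <= p + r.
  by apply: le_trans IH1; rewrite lerDl mulr_ge0// mulr_ge0.
apply: le_trans (lerD (ler_wpM2l a0 IH2) (ler_wpM2l s2 IH1')).
by rewrite le_eqVlt; apply/orP; left; apply/eqP; rewrite -!natr1 !exprS; ring.
Qed.

(** Tangent-line inequality for a convex power, that is, Bernoulli in homogeneous form. *)
Lemma pow_sub_ge q b m : 0 <= b -> b <= q ->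
  q ^+ m.+1 - m.+1%:R * q ^+ m * b <= (q - b) ^+ m.+1.
Proof.
move=> b0 bq; have q0 : 0 <= q := le_trans b0 bq.
elim: m => [|m IH]; first by rewrite expr0 !expr1 mulr1 mul1r.
rewrite [leRHS]exprS.
have qb : 0 <= q - b by rewrite subr_ge0.
apply: le_trans (ler_wpM2l qb IH).
have H : 0 <= m.+1%:R * q ^+ m * b ^+ 2 by rewrite !mulr_ge0 ?exprn_ge0.
rewrite -subr_ge0; apply: le_trans H _.
by rewrite le_eqVlt; apply/orP; left; apply/eqP; rewrite -!natr1 !exprS; ring.
Qed.

End PowerInequalities.

(** * The radial barrier and its second differences *)

Section Barrier.
Variables (R : realType) (n : nat) (c : 'rV[R]_n) (R2 : R) (m : nat).
Hypothesis R2_gt0 : 0 < R2.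
Implicit Types (x y z : 'rV[R]_n).

Definition sd (f : 'rV[R]_n -> R) x z : R := f (x + z) + f (x - z) - 2 * f x.
Definition bump x : R := 1 - enorm2 (x - c) / R2.
Definition barrier x : R := bump x ^+ m.+2.
(** The classical Hessian of [barrier], from the gradient [- 2 (x - c) / R2] of [bump]. Its link
    with [barrier] is expressed below through second differences, without derivatives. *)
Definition barrier_hess x : 'M[R]_n :=
  (- (2 * m.+2%:R * bump x ^+ m.+1 / R2))%:M
  + (4 * (m.+2 * m.+1)%:R * bump x ^+ m / R2 ^+ 2) *: ((x - c)^T *m (x - c)).

Lemma barrier_continuous : continuous barrier.
Proof.
move=> x.
have cb : {for x, continuous bump}.
  have c1 : {for x, continuous (fun y => enorm2 (y - c))}.
    by apply: continuous_comp; [exact: shift_continuous|exact: enorm2_continuous].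
  have c2 : {for x, continuous (fun y => enorm2 (y - c) / R2)}.
    exact: (@continuousM _ _ _ (cst R2^-1) x c1 (@cst_continuous _ _ _ x)).
  exact: (@continuousB _ R^o _ (cst 1) _ x (@cst_continuous _ _ _ x) c2).
exact: (@continuous_comp _ _ _ bump (fun y : R => y ^+ m.+2) x cb (@exprn_continuous R _ _)).
Qed.

Lemma bump_le1 x : bump x <= 1.
Proof. by rewrite gerBl divr_ge0 ?enorm2_ge0// ltW. Qed.

Lemma bump_ge0 x : enorm2 (x - c) <= R2 -> 0 <= bump x.
Proof. by rewrite subr_ge0 ler_pdivrMr// mul1r. Qed.

Lemma bumpD x z : bump (x + z)
  = bump x - enorm2 z / R2 - 2 * dot (x - c) z / R2.
Proof.
rewrite /bump (_ : x + z - c = (x - c) + z); last by rewrite addrAC.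
rewrite enorm2D; ring.
Qed.

(** By [bumpD], [bump] takes the values [a - s] and [a + s] at [x + z] and [x - z], with
    [a = bump x - enorm2 z / R2]: the shape of [second_difference_pow]. *)
Lemma sd_barrier_ge x z : enorm2 z / R2 <= bump x ->
  2 * ((bump x - enorm2 z / R2) ^+ m.+2 - bump x ^+ m.+2)
  + (m.+2 * m.+1)%:R * (bump x - enorm2 z / R2) ^+ m
      * (2 * dot (x - c) z / R2) ^+ 2
  <= sd barrier x z.
Proof.
move=> bx; rewrite /sd /barrier !bumpD dotNr enorm2N mulrN mulNr opprK.
have := @second_difference_pow R (bump x - enorm2 z / R2) (2 * dot (x - c) z / R2) m.
rewrite subr_ge0 => /(_ bx).
set a := bump x - enorm2 z / R2; set s := 2 * dot (x - c) z / R2.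
move=> H; lra.
Qed.

(** A crude bound whose right size is uniform in [x]; it later bounds the second difference of
    [v - kappa * barrier] from above. *)
Lemma sd_barrier_lower x z : enorm2 z / R2 <= bump x ->
  - (2 * m.+2%:R * (enorm2 z / R2)) <= sd barrier x z.
Proof.
move=> bx; apply: le_trans (sd_barrier_ge bx).
have b0 : 0 <= enorm2 z / R2 by rewrite divr_ge0 ?enorm2_ge0// ltW.
have q1 := bump_le1 x; have q0 := le_trans b0 bx.
have P := pow_sub_ge m.+1 b0 bx.
have H : 0 <= (m.+2 * m.+1)%:R * (bump x - enorm2 z / R2) ^+ m
      * (2 * dot (x - c) z / R2) ^+ 2.
  apply: mulr_ge0 (sqr_ge0 _); apply: mulr_ge0; first exact: ler0n.
  by rewrite exprn_ge0// subr_ge0.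
have qm : bump x ^+ m.+1 <= 1 by rewrite exprn_ile1.
have H2 : m.+2%:R * bump x ^+ m.+1 * (enorm2 z / R2) <= m.+2%:R * (enorm2 z / R2).
  by rewrite ler_wpM2r// ler_piMr.
lra.
Qed.

Lemma qf_barrier_hess x z : qf (barrier_hess x) z
  = - (2 * m.+2%:R * bump x ^+ m.+1 * (enorm2 z / R2))
    + (m.+2 * m.+1)%:R * bump x ^+ m * (2 * dot (x - c) z / R2) ^+ 2.
Proof.
rewrite qfD qf_scalar qfZ qf_outer; field; exact: lt0r_neq0.
Qed.

(** One-sided Taylor formula. The quartic error pays for replacing [bump x - enorm2 z / R2] by
    [bump x] in the factor of power [m]; Cauchy-Schwarz inside the ball bounds the square that it
    multiplies. *)
Lemma sd_barrier_hess x z : enorm2 (x - c) <= R2 -> enorm2 z / R2 <= bump x ->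
  qf (barrier_hess x) z - 4 * (m.+2 * m.+1 * m)%:R * (enorm2 z / R2) ^+ 2
  <= sd barrier x z.
Proof.
move=> xR bx; apply: le_trans (sd_barrier_ge bx).
rewrite qf_barrier_hess.
have b0 : 0 <= enorm2 z / R2 by rewrite divr_ge0 ?enorm2_ge0// ltW.
have q1 := bump_le1 x; have q0 := le_trans b0 bx.
have P := pow_sub_ge m.+1 b0 bx.
set b := enorm2 z / R2 in b0 bx P *; set q := bump x in q1 q0 bx P *.
set s := 2 * dot (x - c) z / R2.
have s2 : s ^+ 2 <= 4 * b.
  have := cauchy_schwarz (x - c) z => CS.
  have -> : s ^+ 2 = 4 * (dot (x - c) z ^+ 2 / R2 ^+ 2).
    by rewrite /s; field; exact: lt0r_neq0.
  have -> : b = R2 * enorm2 z / R2 ^+ 2 by rewrite /b; field; exact: lt0r_neq0.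
  rewrite ler_pM2l// ler_pM2r ?invr_gt0 ?exprn_gt0//.
  by apply: le_trans CS _; rewrite ler_wpM2r ?enorm2_ge0.
have Q : q ^+ m - m%:R * b <= (q - b) ^+ m.
  case: (m) => [|k]; first by rewrite !expr0 mul0r subr0.
  apply: le_trans (pow_sub_ge k b0 bx); rewrite lerD2l lerN2.
  by rewrite ler_wpM2r// ler_piMr// exprn_ile1.
have s20 := sqr_ge0 s.
have M0 : 0 <= (m.+2 * m.+1)%:R :> R by [].
have K0 : 0 <= m%:R :> R by [].
have T : (m.+2 * m.+1)%:R * (q ^+ m * s ^+ 2 - m%:R * b * (4 * b))
      <= (m.+2 * m.+1)%:R * ((q - b) ^+ m * s ^+ 2).
  rewrite ler_wpM2l//.
  apply: le_trans (_ : (q ^+ m - m%:R * b) * s ^+ 2 <= _); last by rewrite ler_wpM2r.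
  by rewrite mulrBl lerD2l lerN2 ler_wpM2l// mulr_ge0.
rewrite [(m.+2 * m.+1 * m)%N%:R]natrM.
set M := (m.+2 * m.+1)%:R in T M0 *.
have -> : M * (q - b) ^+ m * s ^+ 2 = M * ((q - b) ^+ m * s ^+ 2) by ring.
have E : M * (q ^+ m * s ^+ 2 - m%:R * b * (4 * b))
   = M * q ^+ m * s ^+ 2 - 4 * (M * m%:R) * b ^+ 2 by ring.
rewrite E in T.
have E2 : 2 * m.+2%:R * q ^+ m.+1 * b = 2 * (m.+2%:R * q ^+ m.+1 * b) by ring.
rewrite E2; lra.
Qed.

Lemma barrier_hess_sym x : (barrier_hess x)^T = barrier_hess x.
Proof.
apply/matrixP => i j; rewrite mxE [LHS]mxE [RHS]mxE; congr (_ + _).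
  by rewrite !mxE eq_sym.
by rewrite [LHS]mxE [RHS]mxE !outerE [in RHS]mulrC (mulrC (_ _ i)) mulrC.
Qed.

Lemma ip_barrier_hess (A : 'M[R]_n) x : ip A (barrier_hess x)
  = - (2 * m.+2%:R * bump x ^+ m.+1 / R2) * \tr A
    + 4 * (m.+2 * m.+1)%:R * bump x ^+ m / R2 ^+ 2 * qf A (x - c).
Proof. by rewrite ipDr ip_scalar ipZr ip_outer. Qed.

End Barrier.


(** * Dyadic cells, densities and the stopping-time argument *)

Section DyadicDensity.
Variables (R : realType) (n : nat).
Implicit Types (c x : 'rV[R]_n) (h : R) (b : {ffun 'I_n -> bool}).
Implicit Types P Q : 'rV[R]_n -> R -> bool.

Definition child c h b : 'rV[R]_n :=
  c + \row_i (if b i then h / 2 else - (h / 2)).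

(* The cube of centre [c] and half-side [h] is the closed sup-norm ball;
   [dens P j c h] is the proportion of its dyadic subcubes of generation [j]
   that satisfy [P]. *)
Fixpoint dens P (j : nat) c h : R :=
  if j is k.+1
  then (2 ^+ n)^-1 * \sum_(b : {ffun 'I_n -> bool}) dens P k (child c h b) (h / 2)
  else (P c h)%:R.

Lemma child_dist c h b : 0 <= h -> `|child c h b - c| <= h / 2.
Proof.
move=> h0; have h2 : 0 <= h / 2 by rewrite divr_ge0.
apply: norm_le_coord => // i; rewrite /child addrAC subrr add0r mxE.
by case: ifP => _; rewrite ?normrN ger0_norm.
Qed.

Lemma child_cover c h x : 0 <= h -> `|x - c| <= h ->
  exists b, `|x - child c h b| <= h / 2.
Proof.
move=> h0 xc; exists [ffun i => 0 <= (x - c) ord0 i].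
have h2 : 0 <= h / 2 by rewrite divr_ge0.
apply: norm_le_coord => // i; rewrite /child opprD addrA.
have := le_trans (coord_le_norm _ i) xc.
move: (x - c) => y; rewrite 2!mxE [X in y _ _ - X]mxE ffunE.
case: ifP => [y0|/negbT]; first by rewrite ger0_norm// ler_norml; lra.
by rewrite -ltNge => y0; rewrite ltr0_norm// ler_norml; lra.
Qed.

Lemma card_children : #|{ffun 'I_n -> bool}|%:R = 2 ^+ n :> R.
Proof. by rewrite card_ffun card_bool card_ord natrX. Qed.

Let two_n : 0 < 2 ^+ n :> R. Proof. exact: exprn_gt0. Qed.

Lemma dens_ge0 P j c h : 0 <= dens P j c h.
Proof.
elim: j c h => [|j IH] c h /=; first exact: ler0n.
by rewrite mulr_ge0 ?invr_ge0 ?(ltW two_n)// sumr_ge0.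
Qed.

Lemma dens_mono P Q j c h : (forall a s, P a s -> Q a s) ->
  dens P j c h <= dens Q j c h.
Proof.
move=> PQ; elim: j c h => [|j IH] c h /=.
  by have := PQ c h; case: (P c h) => // ->.
by rewrite ler_wpM2l ?invr_ge0 ?(ltW two_n)// ler_sum.
Qed.

Lemma densC P j c h : dens (fun a s => ~~ P a s) j c h = 1 - dens P j c h.
Proof.
elim: j c h => [|j IH] c h /=; first by case: (P c h); rewrite ?subrr ?subr0.
under eq_bigr do rewrite IH.
rewrite big_split /= sumrN mulrDr mulrN sumr_const card_children.
by rewrite -card_children -mulr_natr mul1r mulVf// card_children lt0r_neq0.
Qed.

(** Serves as a pigeonhole principle: among finitely many properties that cover all cells, one has
    density at least the inverse of their number. *)
Lemma dens_sum (I : finType) (f : I -> 'rV[R]_n -> R -> bool) j c h :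
  (forall a s, exists i, f i a s) -> 1 <= \sum_i dens (f i) j c h.
Proof.
move=> H; elim: j c h => [|j IH] c h /=.
  have [i fi] := H c h; rewrite (bigD1 i) //= fi lerDl.
  by apply: sumr_ge0 => ? _; exact: ler0n.
rewrite -mulr_sumr exchange_big /= mulrC ler_pdivlMr// mul1r -card_children.
rewrite -sum1_card natr_sum; apply: ler_sum => b _; exact: IH.
Qed.

(** Closed subcubes overlap on faces, so a point may be charged to several children, which only
    enlarges the upper bound. Labels are counted rather than points, as [X] may take the same value
    at different labels. *)
Lemma count_cells (T : eqType) (X : T -> 'rV[R]_n) P (N j : nat) c h (s : seq T) :
  0 <= h ->
  (forall p, p \in s -> `|X p - c| <= h) ->
  (forall p a, p \in s -> `|X p - a| <= h / 2 ^+ j -> P a (h / 2 ^+ j)) ->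
  (forall a, (count (fun p => `|X p - a| <= h / 2 ^+ j)%R s <= N)%N) ->
  (size s)%:R <= N%:R * (2 ^+ n) ^+ j * dens P j c h.
Proof.
elim: j c h s => [|j IH] c h s h0 sc sP sN.
  rewrite expr0 mulr1 /=; move: sP sN; rewrite expr0 divr1 => sP sN.
  case: s sc sP sN => [|p s] sc sP sN; first by rewrite !mulr_ge0.
  rewrite (sP p) ?mem_head ?sc ?mem_head// mulr1 ler_nat.
  apply: leq_trans (sN c).
  have /allP : forall q, q \in p :: s -> `|X q - c| <= h by exact: sc.
  by rewrite all_count => /eqP->.
have hE : h / 2 ^+ j.+1 = h / 2 / 2 ^+ j by rewrite exprS invfM mulrA.
rewrite hE in sP sN; have h2 : 0 <= h / 2 by rewrite divr_ge0.
have IHb b : (size [seq p <- s | `|X p - child c h b| <= h / 2])%:R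
    <= N%:R * (2 ^+ n) ^+ j * dens P j (child c h b) (h / 2).
  apply: IH => // [p|p a|a].
  - by rewrite mem_filter => /andP[].
  - by rewrite mem_filter => /andP[_]; exact: sP.
  - apply: leq_trans (sN a); rewrite count_filter.
    by apply: sub_count => p /andP[].
have : (size s)%:R <= \sum_b (size [seq p <- s | `|X p - child c h b| <= h / 2])%:R :> R.
  rewrite -natr_sum ler_nat; under eq_bigr do rewrite size_filter -sum1_count.
  rewrite -sum1_size (exchange_big_dep predT) //=.
  rewrite big_seq [leqRHS]big_seq; apply: leq_sum => p ps.
  have [b Hb] := child_cover h0 (sc p ps).
  by rewrite (bigD1 b).
move=> /le_trans; apply; apply: le_trans (ler_sum _ (fun b _ => IHb b)) _.
rewrite /= -mulr_sumr exprS.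
rewrite le_eqVlt; apply/orP; left; apply/eqP; rewrite mulrCA.
move: (\sum_b _) => S; rewrite !mulrA; congr (_ * S).
by move: (lt0r_neq0 two_n) ((2 ^+ n) ^+ j) => u v; field.
Qed.

(* The Calderon-Zygmund stopping-time argument, as an induction on the
   dyadic tree. *)
Lemma calderon_zygmund P Q (delta : R) j c h :
  0 <= delta < 1 -> 0 <= h ->
  (forall k a s b, (k < j)%N -> 0 <= s -> `|a - c| + s <= h ->
     s / 2 ^+ k.+1 = h / 2 ^+ j ->
     delta < dens P k (child a s b) (s / 2) ->
     dens Q k.+1 a s = 1) ->
  dens P j c h <= delta -> dens P j c h <= delta * dens Q j c h.
Proof.
move=> /andP[d0 d1] h0; elim: j c h h0 => [|j IH] c h h0 H /=.
  (* A single cell has density 0 or 1, and [delta < 1] excludes 1. *)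
  case: (P c h) => /=; last by rewrite mulr_ge0.
  by move=> d; have := lt_le_trans d1 d; rewrite ltxx.
move=> Pd.
(* A child that is too dense makes [Q] fill the parent, where [Pd] is already the claim; otherwise
   the induction enters every child. *)
have [[b Hb]|nb] := pselect (exists b, delta < dens P j (child c h b) (h / 2)).
  have := H j c h b; rewrite ltnSn subrr normr0 add0r => /(_ isT h0 (lexx _) erefl Hb).
  by move=> /= ->; rewrite mulr1.
rewrite mulrCA ler_wpM2l ?invr_ge0 ?(ltW two_n)// mulr_sumr; apply: ler_sum => b _.
have Pb : dens P j (child c h b) (h / 2) <= delta.
  by rewrite leNgt; apply/negP => ?; apply: nb; exists b.
apply: IH => //; first by rewrite divr_ge0.
move=> k a s b' kj s0 as_ sE; apply: H => //; first exact: ltnW.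
  have cd := child_dist c b h0; rewrite -(subrKA (child c h b)).
  by have := ler_normD (a - child c h b) (child c h b - c); lra.
by rewrite sE exprS invfM mulrA.
Qed.

Lemma dens_eq1 Q j c h : 0 <= h ->
  (forall a, `|a - c| + h / 2 ^+ j <= h -> Q a (h / 2 ^+ j)) -> dens Q j c h = 1.
Proof.
elim: j c h => [|j IH] c h h0 H /=.
  by rewrite (_ : Q c h = true)//; have := H c; rewrite expr0 divr1 subrr normr0 add0r; exact.
under eq_bigr => b _.
  rewrite IH; last first.
    move=> a ac; rewrite -mulrA -invfM -exprS; apply: H.
    have cd := child_dist c b h0; rewrite exprS invfM mulrA.
    rewrite -(subrKA (child c h b)).
    by have := ler_normD (a - child c h b) (child c h b - c); lra.
  - by rewrite divr_ge0.
  over.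
by rewrite sumr_const card_children mulVf// lt0r_neq0.
Qed.

Lemma dens_mono_in P Q j c h : 0 <= h ->
  (forall a, `|a - c| + h / 2 ^+ j <= h -> P a (h / 2 ^+ j) -> Q a (h / 2 ^+ j)) ->
  dens P j c h <= dens Q j c h.
Proof.
elim: j c h => [|j IH] c h h0 H /=.
  have := H c; rewrite expr0 divr1 subrr normr0 add0r => /(_ (lexx _)).
  by case: (P c h) => // ->.
rewrite ler_wpM2l ?invr_ge0 ?(ltW two_n)//; apply: ler_sum => b _.
apply: IH; first by rewrite divr_ge0.
move=> a ac; have := H a; rewrite exprS invfM mulrA; apply.
have cd := child_dist c b h0; rewrite -(subrKA (child c h b)).
by have := ler_normD (a - child c h b) (child c h b - c); lra.
Qed.

Lemma dens_gt0_ex P j c h : 0 <= h -> 0 < dens P j c h ->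
  exists a, `|a - c| + h / 2 ^+ j <= h /\ P a (h / 2 ^+ j).
Proof.
move=> h0 d0; apply: contrapT => no; move: d0; apply/negP; rewrite -leNgt.
have : dens (fun a s => ~~ P a s) j c h = 1.
  by apply: dens_eq1 => // a ac; apply/negP => Pa; apply: no; exists a.
by rewrite densC => /eqP; rewrite subr_eq addrC -subr_eq subrr => /eqP<-.
Qed.

End DyadicDensity.


(** * Contact points of the barrier and their count *)

Lemma mul_le_of_le_div (R : realType) (t a b : R) :
  0 <= t -> 0 <= a -> 0 < b -> t <= b / (a + 1) -> t * a <= b.
Proof.
move=> t0 a0 b0; rewrite ler_pdivlMr; last by lra.
by rewrite mulrDr mulr1 => H; apply: le_trans H; rewrite lerDl.
Qed.

Lemma addn_sub_inj (x y z C : nat) : (z <= x + C)%N -> (z <= y + C)%N ->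
  (x + C - z = y + C - z)%N -> x = y.
Proof. lia. Qed.

Lemma addn_sub_bound (x z C : nat) : (x <= z + C)%N -> (x + C - z < C.*2.+1)%N.
Proof. lia. Qed.

Section Contact.
Variables (R : realType) (n : nat) (lam Lam : R) (m : nat).
Variables (c : 'rV[R]_n) (h t : R).
Variables (v : 'rV[R]_n -> R) (Hv A : 'rV[R]_n -> 'M[R]_n).
Hypotheses (n_gt0 : (0 < n)%N) (lam_gt0 : 0 < lam) (Lam_gt0 : 0 < Lam).
Hypotheses (h_gt0 : 0 < h) (t_gt0 : 0 < t).
Hypothesis m_large : 32 * n%:R ^+ 2 * Lam < m.+1%:R * lam.

(** The Euclidean radius is [8 sqrt(n) h]: on the cube of half-side [3 h] about [c], [bump] is at
    least [1/2], and [kappa] is such that [kappa * barrier >= 2 t] there. *)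
Let R2 : R := 64 * n%:R * h ^+ 2.
Let B : set 'rV[R]_n := [set x | enorm2 (x - c) <= R2].
Let kappa : R := 2 ^+ m.+3 * t.
Let w x : R := v x - kappa * barrier c R2 m x.

Hypothesis v_ge0 : forall x, B x -> 0 <= v x.
Hypothesis v_cont : {within B, continuous v}.
Hypothesis v_hess : forall x, B x -> forall e, 0 < e -> exists d, 0 < d /\
  forall z, B (x + z) -> B (x - z) -> `|z| <= d ->
  `|sd v x z - qf (Hv x) z| <= e * enorm2 z.
Hypothesis Hv_sym : forall x, B x -> (Hv x)^T = Hv x.
Hypothesis A_ell : forall x, B x -> elliptic lam Lam (A x).
Hypothesis v_super : forall x, B x -> ip (A x) (Hv x) <= 0.

(** Measures, in units of [t / h ^+ 2], the paraboloid above [w] at a contact point. The leading 1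
    is the expansion error of [v]; the bracket collects the barrier's second difference, the trace
    bound and the barrier's Hessian. *)
Definition opening : R := 1 + 2 ^+ m.+3 *
  (2 * m.+2%:R + 2 * m.+2%:R * (n%:R * Lam / lam) + 4 * (m.+2 * m.+1)%:R).

Let n1 : 1 <= n%:R :> R. Proof. by rewrite ler1n. Qed.
Let n0 : 0 < n%:R :> R. Proof. by rewrite ltr0n. Qed.
Let h2 : 0 < h ^+ 2. Proof. by rewrite exprn_gt0. Qed.
Let R2_gt0 : 0 < R2.
Proof. by rewrite /R2 !mulr_gt0. Qed.
Let kappa_gt0 : 0 < kappa.
Proof. by rewrite /kappa mulr_gt0// exprn_gt0. Qed.

Let sd_w x z : sd w x z = sd v x z - kappa * sd (barrier c R2 m) x z.
Proof. by rewrite /sd /w; ring. Qed.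

Let in_B x z : enorm2 (x - c) <= h ^+ 2 -> enorm2 z <= 16 * n%:R * h ^+ 2 -> B (x + z).
Proof.
move=> xh zh; rewrite /B /= (_ : x + z - c = (x - c) + z); last by rewrite addrAC.
have : enorm2 ((x - c) + z) <= 2 * enorm2 (x - c) + 2 * enorm2 z.
  move: (x - c) => y; have := enorm2_ge0 (y - z); rewrite !enorm2D enorm2N dotNr; lra.
have : h ^+ 2 <= n%:R * h ^+ 2 by rewrite ler_peMl// ltW.
have := h2; rewrite /R2; move: xh zh; lra.
Qed.

(** At a contact point the second differences of [w] are nonnegative, and the expansions of [v] and
    of [barrier] pass this on to the matrix. *)
Lemma contact_hess_psd (p x : 'rV[R]_n) : B x -> 0 < bump c R2 x ->
  (forall y, B y -> w x + dot p (y - x) <= w y) ->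
  psd (Hv x - kappa *: barrier_hess c R2 m x).
Proof.
move=> Bx bx ctc; set D := barrier_hess c R2 m x.
split; first by rewrite raddfB /= linearZ /= barrier_hess_sym Hv_sym.
move=> z; rewrite leNgt; apply/negP => qneg.
set Q := - qf (Hv x - kappa *: D) z; have Q0 : 0 < Q by rewrite oppr_gt0.
have E0 := enorm2_ge0 z.
have e0 : 0 < Q / (2 * (enorm2 z + 1)) by rewrite divr_gt0// mulr_gt0//; lra.
have [d [d0 vT]] := v_hess Bx e0.
set b := enorm2 z / R2; have b0 : 0 <= b by rewrite divr_ge0// ltW.
set s := 2 * dot (x - c) z / R2.
set K : R := 4 * (m.+2 * m.+1 * m)%:R; have K0 : 0 <= K by rewrite mulr_ge0.
(* The scaling [r] keeps both shifted points in the ball and within the range of the expansion of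
   [v], and makes the barrier's quartic error at most [Q / 4]. The error of [v] takes at most
   [Q / 2], so the second difference would be negative. *)
set r := Num.min 1 (Num.min (d / (`|z| + 1)) (Num.min (bump c R2 x / (b + `|s| + 1))
   ((Q / 4) / (kappa * K * b ^+ 2 + 1)))).
have a0 : 0 <= kappa * K * b ^+ 2 by rewrite mulr_ge0 ?sqr_ge0// mulr_ge0// ltW.
have bs0 : 0 <= b + `|s| by rewrite addr_ge0.
have r0 : 0 < r.
  rewrite /r !lt_min ltr01 !divr_gt0//=; try (by apply: ltr_wpDl).
have r1 : r <= 1 by rewrite /r ge_min lexx.
have rz : r * `|z| <= d.
  by apply: mul_le_of_le_div => //; [exact: ltW|rewrite /r !ge_min lexx orbT].
have rb : r * (b + `|s|) <= bump c R2 x.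
  by apply: mul_le_of_le_div => //; [exact: ltW|rewrite /r !ge_min lexx !orbT].
have rQ : r * (kappa * K * b ^+ 2) <= Q / 4.
  by apply: mul_le_of_le_div => //; [exact: ltW|rewrite divr_gt0|rewrite /r !ge_min lexx !orbT].
have rr : r ^+ 2 <= r by rewrite expr2 ler_piMl// ltW.
have r2 : 0 < r ^+ 2 by rewrite exprn_gt0.
have zE : enorm2 (r *: z) / R2 = r ^+ 2 * b by rewrite enorm2Z /b mulrA.
have sE : 2 * dot (x - c) (r *: z) / R2 = r * s by rewrite dotZr /s; ring.
have bnd : r ^+ 2 * b + r * `|s| <= bump c R2 x.
  by apply: le_trans rb; rewrite mulrDr lerD2r ler_wpM2r.
have rs : 0 <= r * `|s| by rewrite mulr_ge0// ltW.
have Bb y : 0 <= bump c R2 y -> B y.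
  by rewrite /bump subr_ge0 ler_pdivrMr// mul1r.
have rsn : r * s <= r * `|s| /\ - (r * s) <= r * `|s|.
  by rewrite -mulrN !ler_pM2l// ler_norm -normrN ler_norm.
have Bp : B (x + r *: z).
  by apply: Bb; rewrite bumpD zE sE; case: rsn; lra.
have Bm : B (x - r *: z).
  by apply: Bb; rewrite bumpD dotNr enorm2N mulrN mulNr zE sE; case: rsn; lra.
have := vT _ Bp Bm; rewrite normrZ (gtr0_norm r0) => /(_ rz).
rewrite ler_norml => /andP[_]; rewrite qfZv enorm2Z => Tv.
have Tb := @sd_barrier_hess R n c R2 m R2_gt0 x (r *: z) Bx.
rewrite zE in Tb; have {}Tb := Tb (le_trans (_ : _ <= r ^+ 2 * b + r * `|s|) bnd).
have {Tb} := Tb ltac:(by rewrite lerDl); rewrite qfZv -/D -/K => Tb.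
have shiftK y : x + y - x = y by rewrite addrAC subrr add0r.
have cp := ctc _ Bp; have cm := ctc _ Bm.
rewrite shiftK dotNr in cm; rewrite shiftK in cp.
have sw : 0 <= sd w x (r *: z) by rewrite /sd; lra.
rewrite sd_w in sw.
have Tb' := ler_wpM2l (ltW kappa_gt0) Tb.
have eE : Q / (2 * (enorm2 z + 1)) * enorm2 z <= Q / 2.
  rewrite mulrAC ler_pdivrMr; last by rewrite mulr_gt0//; lra.
  by have := mulr_ge0 (ltW Q0) E0; lra.
have QE : qf (Hv x) z - kappa * qf D z = - Q by rewrite /Q opprK qfB qfZ.
have r4 : r ^+ 2 * (kappa * K * b ^+ 2) <= Q / 4.
  by apply: le_trans rQ; rewrite ler_wpM2r.
have : 0 <= r ^+ 2 * (- Q + Q / (2 * (enorm2 z + 1)) * enorm2 z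
                      + r ^+ 2 * (kappa * K * b ^+ 2)).
  rewrite -QE; apply: le_trans sw _; rewrite -subr_ge0.
  have -> : r ^+ 2 * (qf (Hv x) z - kappa * qf D z +
     Q / (2 * (enorm2 z + 1)) * enorm2 z + r ^+ 2 * (kappa * K * b ^+ 2))
     - (sd v x (r *: z) - kappa * sd (barrier c R2 m) x (r *: z))
   = (Q / (2 * (enorm2 z + 1)) * (r ^+ 2 * enorm2 z)
      - (sd v x (r *: z) - r ^+ 2 * qf (Hv x) z))
    + (kappa * sd (barrier c R2 m) x (r *: z)
      - kappa * (r ^+ 2 * qf D z - K * (r ^+ 2 * b) ^+ 2)) by ring.
  by rewrite addr_ge0// subr_ge0.
rewrite pmulr_rge0// => ?; lra.
Qed.

(** The contact point minimises [w - dot p] over the ball. Contact bounds the Hessian of [w] from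
    below, and ellipticity turns this, with the supersolution inequality, into a bound from
    above. *)
Lemma contact_point (p x0 : 'rV[R]_n) :
  (forall i, `|p ord0 i| <= t / (32 * n%:R ^+ 2 * h)) ->
  `|x0 - c| <= 3 * h -> v x0 <= t ->
  exists x, [/\ enorm2 (x - c) < h ^+ 2, v x <= kappa,
    (forall y, B y -> w x + dot p (y - x) <= w y) &
    forall z, enorm2 z <= 16 * n%:R * h ^+ 2 ->
      sd v x z <= qf (Hv x) z + t / h ^+ 2 * enorm2 z ->
      w (x + z) <= w x + dot p z + opening * t / h ^+ 2 * enorm2 z].
Proof.
move=> psmall x0c vx0.
have x0E : enorm2 (x0 - c) <= 9 * n%:R * h ^+ 2.
  apply: le_trans (enorm2_le_norm _) _.
  have : `|x0 - c| ^+ 2 <= (3 * h) ^+ 2 by rewrite lerXn2r ?nnegrE// mulr_ge0// ltW.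
  move=> /(ler_wpM2l (ltW n0)); lra.
have Bx0 : B x0 by rewrite /B /= /R2; have := mulr_gt0 n0 h2; lra.
have [x xB xmin] : exists2 x, x \in B & forall y, y \in B ->
    v x - (kappa * barrier c R2 m x + dot p x)
    <= v y - (kappa * barrier c R2 m y + dot p y).
  apply: (@compact_EVT_min _ _ (v - (fun y => kappa * barrier c R2 m y + dot p y)) B).
  - by exists x0.
  - exact: compact_eball.
  - move=> y; apply: (@continuousB _ R^o _ _ _ y); first exact: v_cont.
    apply: continuous_subspaceT => u.
    exact: (@continuousD _ R^o _ _ _ u (@continuousM _ _ (cst kappa) _ u
      (@cst_continuous _ _ _ u) (@barrier_continuous _ _ _ _ _ u))
      (@dot_continuous _ _ p u)).
have Bx : B x by rewrite inE in xB.
have ctc y : B y -> w x + dot p (y - x) <= w y.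
  move=> By; have := xmin y; rewrite inE => /(_ By); rewrite dotDr dotNr /w; lra.
have pE : enorm2 p <= n%:R * (t / (32 * n%:R ^+ 2 * h)) ^+ 2 by exact: enorm2_le_coord.
have pB y : B y -> `|dot p (y - c)| <= t / 4.
  move=> By; rewrite -[leLHS]ger0_norm// -sqrtr_sqr real_normK ?num_real//.
  rewrite -[leRHS]ger0_norm -?sqrtr_sqr; last by rewrite divr_ge0// ltW.
  apply: ler_wsqrtr; apply: le_trans (cauchy_schwarz _ _) _.
  apply: le_trans (ler_pM (enorm2_ge0 _) (enorm2_ge0 _) pE By) _.
  have -> : n%:R * (t / (32 * n%:R ^+ 2 * h)) ^+ 2 * R2 = (t / 4) ^+ 2 / n%:R ^+ 2.
    by rewrite /R2; field; rewrite !lt0r_neq0.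
  by rewrite ler_pdivrMr ?exprn_gt0// ler_peMr ?sqr_ge0// exprn_ege1.
have bx0 : 2^-1 <= bump c R2 x0.
  rewrite /bump lerBrDl -lerBrDr ler_pdivrMr// /R2; have := mulr_gt0 n0 h2; lra.
have wx0 : w x0 <= - t.
  rewrite /w /kappa.
  have : 2^-1 ^+ m.+2 <= barrier c R2 m x0 by rewrite lerXn2r ?nnegrE//; lra.
  move=> /(ler_wpM2l (ltW kappa_gt0)).
  have -> : kappa * 2^-1 ^+ m.+2 = 2 * t.
    have p2 : 2 ^+ m.+2 != 0 :> R by rewrite expf_neq0.
    by rewrite /kappa exprVn (exprS _ m.+2); move: (2 ^+ m.+2) p2 => k k0; field.
  by rewrite /kappa; lra.
(* The tilt costs at most [t / 4] at each of the two points. Since [w = v >= 0] where the barrier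
   vanishes, a negative value puts the contact point in the interior. *)
have wx : w x <= - (t / 2).
  have := ctc x0 Bx0; have := pB _ Bx; have := pB _ Bx0.
  rewrite !ler_norml !dotDr !dotNr => /andP[a1 _] /andP[_ a2]; lra.
have q1 := bump_le1 c R2_gt0 x; have q0 := bump_ge0 R2_gt0 Bx.
have bp : 0 < bump c R2 x.
  rewrite lt0r q0 andbT; apply/eqP => b0.
  by move: wx; rewrite /w /barrier b0 expr0n mulr0 subr0; have := v_ge0 Bx; have := t_gt0; lra.
have vk : v x <= kappa.
  have : kappa * barrier c R2 m x <= kappa.
    by rewrite ler_piMr ?exprn_ile1// ltW.
  by move: wx t_gt0; rewrite /w; lra.
have P := contact_hess_psd Bx bp ctc.
set D := barrier_hess c R2 m x in P.
have ipP := elliptic_ip_psd (A_ell Bx) P.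
have tP := psd_trace_ge0 P.
rewrite ipBr ipZr in ipP; have sup := v_super Bx.
have [_ trA] := trace_le_elliptic (A_ell Bx).
have [qA _] := A_ell Bx (x - c).
have ipD : - (2 * m.+2%:R * (n%:R * Lam) / R2)
     <= ip (A x) D.
  rewrite /D ip_barrier_hess.
  have : 0 <= 4 * (m.+2 * m.+1)%:R * bump c R2 x ^+ m / R2 ^+ 2 * qf (A x) (x - c).
    apply: mulr_ge0; last by apply: le_trans qA; rewrite mulr_ge0 ?enorm2_ge0// ltW.
    by rewrite divr_ge0 ?sqr_ge0// mulr_ge0 ?exprn_ge0// mulr_ge0.
  have : 2 * m.+2%:R * bump c R2 x ^+ m.+1 / R2 * \tr (A x)
       <= 2 * m.+2%:R * (n%:R * Lam) / R2.
    rewrite mulrAC ler_pM2r ?invr_gt0// -!mulrA ler_pM2l// ler_pM2l//.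
    apply: le_trans (_ : bump c R2 x ^+ m.+1 * (n%:R * Lam) <= _).
      by rewrite ler_wpM2l// exprn_ge0.
    by rewrite ler_piMl ?exprn_ile1// mulr_ge0// ltW.
  lra.
(* At interior points at Euclidean distance at least [h] from [c], [m_large] makes the barrier a
   strict subsolution, so contact there would contradict [v_super]. *)
have xh : enorm2 (x - c) < h ^+ 2.
  rewrite ltNge; apply/negP => hx.
  suff : 0 < ip (A x) D by move=> /(mulr_gt0 kappa_gt0); have := mulr_ge0 (ltW lam_gt0) tP; lra.
  rewrite /D ip_barrier_hess.
  have -> : - (2 * m.+2%:R * bump c R2 x ^+ m.+1 / R2) * \tr (A x) +
    4 * (m.+2 * m.+1)%:R * bump c R2 x ^+ m / R2 ^+ 2 * qf (A x) (x - c)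
    = bump c R2 x ^+ m * m.+2%:R * 2 / R2 *
     (2 * m.+1%:R * qf (A x) (x - c) / R2 - bump c R2 x * \tr (A x)).
    by rewrite natrM exprS; field; exact: lt0r_neq0.
  apply: mulr_gt0; first by rewrite divr_gt0// !mulr_gt0// exprn_gt0.
  rewrite subr_gt0; apply: le_lt_trans (_ : n%:R * Lam < _).
    apply: le_trans (ler_wpM2l q0 trA) _.
    by rewrite ler_piMl// mulr_ge0// ltW.
  rewrite ltr_pdivlMr//.
  apply: lt_le_trans (_ : 2 * m.+1%:R * (lam * h ^+ 2) <= _); last first.
    rewrite ler_wpM2l ?mulr_ge0//; apply: le_trans qA.
    by rewrite ler_pM2l.
  have -> : n%:R * Lam * R2 = 2 * h ^+ 2 * (32 * n%:R ^+ 2 * Lam) by rewrite /R2; ring.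
  have -> : 2 * m.+1%:R * (lam * h ^+ 2) = 2 * h ^+ 2 * (m.+1%:R * lam) by ring.
  by rewrite ltr_pM2l// mulr_gt0.
exists x; split=> // z zh vz.
have E0 := enorm2_ge0 z.
have Bp : B (x + z) by apply: in_B => //; exact: ltW.
have Bm : B (x - z) by apply: in_B; rewrite ?enorm2N// ltW.
have bz : enorm2 z / R2 <= bump c R2 x.
  have nh : h ^+ 2 <= n%:R * h ^+ 2 by rewrite ler_peMl// ltW.
  rewrite /bump lerBrDl -mulrDl ler_pdivrMr// mul1r.
  rewrite /R2; move: xh zh nh h2; lra.
(* The trace of a positive semidefinite matrix controls it entirely, so bounding it bounds the
   Hessian of [w] from above. *)
have trP : \tr (Hv x - kappa *: D) <= kappa * (2 * m.+2%:R * (n%:R * Lam / lam)) / R2.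
  have /(ler_wpM2l (ltW kappa_gt0)) H := ipD.
  have H2 : lam * \tr (Hv x - kappa *: D) <= kappa * (2 * m.+2%:R * (n%:R * Lam) / R2).
    by move: H; rewrite mulrN; lra.
  rewrite -(ler_pM2l lam_gt0); apply: le_trans H2 _.
  rewrite le_eqVlt; apply/orP; left; apply/eqP; field.
  by rewrite !lt0r_neq0.
have qP := psd_qf_le z P; rewrite qfB qfZ in qP.
have trP' := ler_wpM2r E0 trP.
have qD : qf D z <= 4 * (m.+2 * m.+1)%:R / R2 * enorm2 z.
  rewrite /D qf_barrier_hess//.
  have g1 : 0 <= 2 * m.+2%:R * bump c R2 x ^+ m.+1 * (enorm2 z / R2).
    by rewrite mulr_ge0 ?divr_ge0 ?(ltW R2_gt0)// mulr_ge0 ?exprn_ge0.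
  suff : (m.+2 * m.+1)%:R * bump c R2 x ^+ m * (2 * dot (x - c) z / R2) ^+ 2
     <= 4 * (m.+2 * m.+1)%:R / R2 * enorm2 z by lra.
  have CS : dot (x - c) z ^+ 2 <= R2 * enorm2 z.
    by apply: le_trans (cauchy_schwarz _ _) _; rewrite ler_wpM2r.
  have -> : (2 * dot (x - c) z / R2) ^+ 2 = 4 / R2 ^+ 2 * dot (x - c) z ^+ 2.
    by field; exact: lt0r_neq0.
  apply: le_trans (_ : (m.+2 * m.+1)%:R * 1 * (4 / R2 ^+ 2 * (R2 * enorm2 z)) <= _).
    apply: ler_pM.
    - by rewrite mulr_ge0 ?exprn_ge0.
    - by rewrite mulr_ge0 ?sqr_ge0// divr_ge0// sqr_ge0.
    - by rewrite ler_wpM2l// exprn_ile1.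
    - by rewrite ler_wpM2l// divr_ge0// sqr_ge0.
  by rewrite le_eqVlt; apply/orP; left; apply/eqP; field; exact: lt0r_neq0.
have lowb := sd_barrier_lower m R2_gt0 bz.
have swz : sd w x z <= opening * t / h ^+ 2 * enorm2 z.
  rewrite sd_w.
  have k1 := ler_wpM2l (ltW kappa_gt0) lowb.
  have k2 := ler_wpM2l (ltW kappa_gt0) qD.
  apply: le_trans (_ : t / h ^+ 2 * enorm2 z + kappa / R2 * (2 * m.+2%:R +
       2 * m.+2%:R * (n%:R * Lam / lam) + 4 * (m.+2 * m.+1)%:R) * enorm2 z <= _).
    rewrite -subr_ge0.
    have -> : t / h ^+ 2 * enorm2 z +
      kappa / R2 * (2 * m.+2%:R + 2 * m.+2%:R * (n%:R * Lam / lam) +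
         4 * (m.+2 * m.+1)%:R) * enorm2 z - (sd v x z - kappa * sd (barrier c R2 m) x z)
    = (qf (Hv x) z + t / h ^+ 2 * enorm2 z - sd v x z)
     + (kappa * sd (barrier c R2 m) x z - kappa * - (2 * m.+2%:R * (enorm2 z / R2)))
     + (kappa * (4 * (m.+2 * m.+1)%:R / R2 * enorm2 z) - kappa * qf D z)
     + (kappa * (2 * m.+2%:R * (n%:R * Lam / lam)) / R2 * enorm2 z
        - (qf (Hv x) z - kappa * qf D z)) by ring.
    apply: addr_ge0; last by rewrite subr_ge0; exact: le_trans qP trP'.
    by apply: addr_ge0; [apply: addr_ge0|]; rewrite subr_ge0.
  rewrite -mulrDl ler_wpM2r// /opening.
  set S := (X in kappa / R2 * X); have S0 : 0 <= S.
    have L0 : 0 <= n%:R * Lam / lam by rewrite divr_ge0 ?mulr_ge0 ?ltW.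
    have M0 (k : nat) : 0 <= k%:R :> R by exact: ler0n.
    have := M0 (m.+2 * m.+1)%N; have := M0 m.+2.
    by move=> a1 /(mulr_ge0 (M0 4)) a2; have := mulr_ge0 a1 L0; rewrite /S; lra.
  have -> : (1 + 2 ^+ m.+3 * S) * t / h ^+ 2 = t / h ^+ 2 + 2 ^+ m.+3 * t / h ^+ 2 * S.
    by ring.
  rewrite lerD2l.
  rewrite ler_wpM2r// -/kappa ler_pM2l// lef_pV2 ?posrE// /R2.
  have : h ^+ 2 <= n%:R * h ^+ 2 by rewrite ler_peMl// ltW.
  have := h2; lra.
(* Contact from below at [x - z] converts the bound on the second difference into one on [w (x + z)]
   alone. *)
have := ctc _ Bm; rewrite (_ : x - z - x = - z) ?dotNr; last by rewrite addrAC subrr add0r.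
by move: swz; rewrite /sd; lra.
Qed.

(* Two contact points in one cell have nearby slopes, since [w] has a
   tangent paraboloid from above at contact points. *)
Lemma contact_slopes_close (p p' x x' : 'rV[R]_n) (eta : R) i :
  0 < eta -> eta <= h ->
  enorm2 (x - c) < h ^+ 2 -> enorm2 (x' - c) < h ^+ 2 ->
  (forall y, B y -> w x + dot p (y - x) <= w y) ->
  (forall y, B y -> w x' + dot p' (y - x') <= w y) ->
  (forall z, `|z| <= 4 * eta ->
      w (x + z) <= w x + dot p z + opening * t / h ^+ 2 * enorm2 z) ->
  `|x - x'| <= 2 * eta ->
  p' ord0 i - p ord0 i <= 8 * n%:R * opening * (t * eta / h ^+ 2).
Proof.
move=> e0 eh xh xh' cx cx' up xx'.
(* At [x' + d], [w] lies above the plane of slope [p'] through [x'], and at [x'] above the plane of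
   slope [p] through [x]; the paraboloid at [x] bounds it from above. A step [d] along one axis, of
   the size of the cell, isolates the [i]-th components. *)
pose d : 'rV[R]_n := (2 * eta) *: delta_mx ord0 i.
have dn : `|d| <= 2 * eta.
  apply: norm_le_coord => [|k]; first by rewrite mulr_ge0// ltW.
  rewrite !mxE normrM (ger0_norm (_ : 0 <= 2 * eta)); last by rewrite mulr_ge0// ltW.
  by rewrite ler_piMr ?mulr_ge0 ?(ltW e0)//; case: (_ && _); rewrite ?normr1 ?normr0.
have eh2 : eta ^+ 2 <= h ^+ 2 by rewrite lerXn2r ?nnegrE ?(ltW e0) ?(ltW h_gt0).
have By : B (x' + d).
  apply: in_B; first exact: ltW.
  rewrite enorm2Z enorm2_delta mulr1.
  have : h ^+ 2 <= n%:R * h ^+ 2 by rewrite ler_peMl// ltW.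
  by move: eh2 h2; lra.
have Bx' : B x'.
  rewrite -[x']addr0; apply: in_B; first exact: ltW.
  by rewrite enorm2E /dot big1 => [|k _]; rewrite ?mxE ?mulr0// !mulr_ge0// ltW.
set z := x' + d - x.
have zn : `|z| <= 4 * eta.
  rewrite /z (_ : x' + d - x = d - (x - x')); last by rewrite opprB addrA (addrC d).
  by apply: le_trans (ler_normB _ _) _; lra.
have := up z zn; rewrite /z addrC subrK => U.
have L' := cx' _ By; have L := cx _ Bx'.
rewrite [x' + d - x']addrAC subrr add0r in L'.
have zE : enorm2 (x' + d - x) <= 16 * n%:R * eta ^+ 2.
  apply: le_trans (enorm2_le_norm _) _.
  have : `|z| ^+ 2 <= (4 * eta) ^+ 2 by rewrite lerXn2r ?nnegrE// mulr_ge0// ltW.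
  by move=> /(ler_wpM2l (ltW n0)); rewrite /z; lra.
have op0 : 0 <= opening.
  have L0 : 0 <= n%:R * Lam / lam by rewrite divr_ge0 ?mulr_ge0 ?ltW.
  have M0 (k : nat) : 0 <= k%:R :> R by exact: ler0n.
  apply: addr_ge0 => //; apply: mulr_ge0; first by rewrite exprn_ge0.
  have := M0 (m.+2 * m.+1)%N; have := M0 m.+2.
  by move=> a1 a2; have := mulr_ge0 a1 L0; lra.
have C1 : 0 <= opening * t / h ^+ 2 by exact: divr_ge0 (mulr_ge0 op0 (ltW t_gt0)) (ltW h2).
have K := ler_wpM2l C1 zE.
have pd : dot p' d - dot p d = 2 * eta * (p' ord0 i - p ord0 i).
  by rewrite /d !dotZr !dot_delta; ring.
have : 2 * eta * (p' ord0 i - p ord0 i)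
    <= 2 * eta * (8 * n%:R * opening * (t * eta / h ^+ 2)).
  have -> : 2 * eta * (8 * n%:R * opening * (t * eta / h ^+ 2))
    = opening * t / h ^+ 2 * (16 * n%:R * eta ^+ 2) by ring.
  rewrite -pd; move: U L L' K; rewrite !dotDr !dotNr; lra.
by rewrite ler_pM2l// mulr_gt0.
Qed.

(** At least [(2 ^ j / (32 n ^ 2)) ^ n] slopes are used, at most [(2 C0 + 1) ^ n] of them have
    contact points in one cell, and there are [2 ^ (n j)] cells: the quotient is free of [j]. *)
Definition density_bound (C0 : nat) : R := ((32 * n ^ 2 * C0.*2.+1) ^ n)%:R^-1.

(** The discrete counterpart of the Alexandrov-Bakelman-Pucci estimate. *)
Lemma density_growth (C0 j : nat) (x0 : 'rV[R]_n) :
  8 * n%:R * opening <= C0%:R ->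
  (forall x z, B x -> B (x + z) -> B (x - z) -> `|z| <= 4 * (h / 2 ^+ j) ->
     sd v x z <= qf (Hv x) z + t / h ^+ 2 * enorm2 z) ->
  `|x0 - c| <= 3 * h -> v x0 <= t ->
  density_bound C0 <=
    dens (fun a s => `[< exists x, `|x - a| <= s /\ v x <= kappa >]) j c h.
Proof.
move=> hC vs x0c vx0; set eta := h / 2 ^+ j.
have p2 : 0 < 2 ^+ j :> R by rewrite exprn_gt0.
have e0 : 0 < eta by rewrite divr_gt0.
have eh : eta <= h by rewrite ler_pdivrMr// ler_peMr ?(ltW h_gt0)// exprn_ege1// ler1n.
pose k := (2 ^ j %/ (32 * n ^ 2))%N.
have kn : 0 < 32 * n%:R ^+ 2 :> R by rewrite mulr_gt0// exprn_gt0.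
pose sg := t * eta / h ^+ 2.
have sg0 : 0 < sg by rewrite divr_gt0// mulr_gt0.
pose slope (f : {ffun 'I_n -> 'I_k.+1}) : 'rV[R]_n := \row_i (sg * (f i)%:R).
have slope_small f i : `|slope f ord0 i| <= t / (32 * n%:R ^+ 2 * h).
  rewrite mxE ger0_norm; last by rewrite mulr_ge0// ltW.
  have fk : (f i)%:R <= 2 ^+ j / (32 * n%:R ^+ 2) :> R.
    rewrite ler_pdivlMr// -natrX -!natrM -natrX ler_nat.
    apply: leq_trans (leq_divM (2 ^ j) (32 * n ^ 2)).
    by rewrite leq_mul2r -ltnS ltn_ord orbT.
  apply: le_trans (ler_wpM2l (ltW sg0) fk) _.
  rewrite le_eqVlt; apply/orP; left; apply/eqP; rewrite /sg /eta.
  by move: (2 ^+ j) p2 => r r0; field; rewrite !lt0r_neq0.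
have /choice[X HX] f := contact_point (slope_small f) x0c vx0.
have smallz (z : 'rV[R]_n) : `|z| <= 4 * eta -> enorm2 z <= 16 * n%:R * h ^+ 2.
  move=> zn; apply: le_trans (enorm2_le_norm _) _.
  have : `|z| ^+ 2 <= (4 * h) ^+ 2.
    by rewrite lerXn2r ?nnegrE ?mulr_ge0 ?(ltW h_gt0)//; lra.
  by move=> /(ler_wpM2l (ltW n0)); lra.
have up f (z : 'rV[R]_n) : `|z| <= 4 * eta -> w (X f + z)
    <= w (X f) + dot (slope f) z + opening * t / h ^+ 2 * enorm2 z.
  move=> zn; have [xh _ _ U] := HX f; have zs := smallz _ zn; apply: U => //.
  have xh' : enorm2 (X f - c) <= h ^+ 2 by exact: ltW.
  apply: vs => //; last 2 first.
  - exact: in_B.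
  - by apply: in_B => //; rewrite enorm2N.
  - rewrite -[X f]addr0; apply: in_B => //.
    by rewrite enorm2E /dot big1 => [|i _]; rewrite ?mxE ?mulr0// !mulr_ge0// ltW.
have close f g a i : `|X f - a| <= eta -> `|X g - a| <= eta ->
    (g i <= f i + C0)%N.
  move=> fa ga; have [xf _ cf _] := HX f; have [xg _ cg _] := HX g.
  have fg : `|X f - X g| <= 2 * eta.
    rewrite (_ : X f - X g = (X f - a) - (X g - a)); last by rewrite opprB addrA subrK.
    by apply: le_trans (ler_normB _ _) _; lra.
  have := contact_slopes_close i e0 eh xf xg cf cg (up f) fg.
  rewrite !mxE -mulrBr mulrC ler_pM2r// => H.
  by have := le_trans H hC; rewrite lerBlDr -natrD ler_nat addnC.
have fib a : (count (fun f => `|X f - a| <= h / 2 ^+ j)%R (enum {ffun 'I_n -> 'I_k.+1})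
    <= C0.*2.+1 ^ n)%N.
  rewrite -/eta -size_filter.
  set s := seq.filter _ _; case E: s => [//|f0 s'].
  have sin f : f \in s -> `|X f - a| <= eta by rewrite mem_filter => /andP[].
  have f0a : `|X f0 - a| <= eta by apply: sin; rewrite E mem_head.
  (* Within one cell the indices stay within [C0] of those of [f0], so their shifted differences
     take at most [2 C0 + 1] values per coordinate. *)
  rewrite -E; pose phi (f : {ffun 'I_n -> 'I_k.+1}) : {ffun 'I_n -> 'I_C0.*2.+1} :=
    [ffun i => inord (f i + C0 - f0 i)%N].
  have inj : {in s &, injective phi}.
    move=> f g fs gs /ffunP fg; apply/ffunP => i; apply/val_inj => /=.
    have := congr1 val (fg i); rewrite !ffunE /= !inordK.
    - exact: addn_sub_inj (close f f0 a i (sin _ fs) f0a) (close g f0 a i (sin _ gs) f0a).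
    - exact: addn_sub_bound (close f0 g a i f0a (sin _ gs)).
    - exact: addn_sub_bound (close f0 f a i f0a (sin _ fs)).
  rewrite -(size_map phi) -[leqRHS](_ : #|{ffun 'I_n -> 'I_C0.*2.+1}| = _); last first.
    by rewrite card_ffun !card_ord.
  rewrite -[size _](card_uniqP _) ?max_card// map_inj_in_uniq//.
  by rewrite filter_uniq// enum_uniq.
pose P (a : 'rV[R]_n) (s : R) := `[< exists x, `|x - a| <= s /\ v x <= kappa >].
have : (size (enum {ffun 'I_n -> 'I_k.+1}))%:R
    <= (C0.*2.+1 ^ n)%:R * (2 ^+ n) ^+ j * dens P j c h.
  apply: (@count_cells R n _ X) => // [|f _|f a _ fa].
  - exact: ltW.
  - have [xh _ _ _] := HX f; rewrite -(@ler_pXn2r _ 2) ?nnegrE ?(ltW h_gt0)//.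
    by apply: le_trans (norm_sqr_le_enorm2 _) (ltW xh).
  - by apply/asboolP; exists (X f); split=> //; have [] := HX f.
rewrite -cardE card_ffun !card_ord.
rewrite -/P; set D := dens _ _ _ _ => H.
rewrite /density_bound -div1r ler_pdivrMr; last first.
  by rewrite ltr0n expn_gt0 !muln_gt0 n_gt0.
have kk : (2 ^ j <= k.+1 * (32 * n ^ 2))%N.
  by rewrite ltnW// ltn_ceil// !muln_gt0 n_gt0.
have : ((2 ^ j) ^ n)%:R <= ((C0.*2.+1 * (32 * n ^ 2)) ^ n * (2 ^ j) ^ n)%:R * D.
  apply: le_trans (_ : (k.+1 ^ n * (32 * n ^ 2) ^ n)%:R <= _).
    by rewrite ler_nat -expnMn leq_exp2r.
  rewrite natrM; apply: le_trans (ler_wpM2r _ H) _; first exact: ler0n.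
  rewrite le_eqVlt; apply/orP; left; apply/eqP.
  rewrite !expnMn !natrM -[(2 ^+ n) ^+ j]exprM -expnM (mulnC j) !natrX; ring.
rewrite natrM mulrAC -[leLHS]mul1r ler_pM2r ?ltr0n ?expn_gt0 ?expn_gt0//.
by rewrite mulrC (mulnC C0.*2.+1).
Qed.

End Contact.


(** * The discrete weak Harnack inequality *)

Section WeakHarnack.
Variables (R : realType) (n : nat) (lam Lam : R) (m C0 : nat).
Variables (v : 'rV[R]_n -> R) (Hv A : 'rV[R]_n -> 'M[R]_n) (t0 : R) (J : nat).
Hypotheses (n_gt0 : (0 < n)%N) (lam_gt0 : 0 < lam) (Lam_gt0 : 0 < Lam).
Hypothesis m_large : 32 * n%:R ^+ 2 * Lam < m.+1%:R * lam.
Hypothesis C0_large : 8 * n%:R * opening n lam Lam m <= C0%:R.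
Hypothesis t0_gt0 : 0 < t0.

Let S : set 'rV[R]_n := [set x | `|x| <= 2^-1].
(** Since [9 n h0 = 1/2], the Euclidean balls of radius [8 sqrt(n) s] about subcubes of the initial
    cube stay within [S]. *)
Let h0 : R := (18 * n%:R)^-1.
Let mu : R := density_bound R n C0.
Let M : R := 2 ^+ m.+3.

Hypothesis v_ge0 : forall x, S x -> 0 <= v x.
Hypothesis v_cont : {within S, continuous v}.
Hypothesis v_hess : forall x, S x -> forall e, 0 < e -> exists d, 0 < d /\
  forall z, S (x + z) -> S (x - z) -> `|z| <= d ->
  `|sd v x z - qf (Hv x) z| <= e * enorm2 z.
(** This ties [J] to [v]: a one-sided expansion valid uniformly at the scale of the smallest
    cells. *)
Hypothesis v_small : forall x z, S x -> S (x + z) -> S (x - z) ->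
  `|z| <= 4 * (h0 / 2 ^+ J) -> sd v x z <= qf (Hv x) z + t0 * enorm2 z.
Hypothesis Hv_sym : forall x, S x -> (Hv x)^T = Hv x.
Hypothesis A_ell : forall x, S x -> elliptic lam Lam (A x).
Hypothesis v_super : forall x, S x -> ip (A x) (Hv x) <= 0.

Let above k (a : 'rV[R]_n) (s : R) :=
  `[< forall x, `|x - a| <= s -> M ^+ k * t0 < v x >].

(** This is [density_growth] at level [M ^+ k * t0], read on the complement: one low point within
    three half-sides makes a fraction [mu] of the cells contain a value of at most
    [M ^+ k.+1 * t0]. *)
Lemma density_above k j (a x : 'rV[R]_n) (s : R) :
  0 < s -> `|a| + s <= h0 -> s / 2 ^+ j = h0 / 2 ^+ J ->
  `|x - a| <= 3 * s -> v x <= M ^+ k * t0 ->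
  dens (above k.+1) j a s <= 1 - mu.
Proof.
move=> s0 as_ sE xa vx.
have n1 : 1 <= n%:R :> R by rewrite ler1n.
have n0 : 0 < n%:R :> R by rewrite ltr0n.
have t1 : 0 < M ^+ k * t0 by rewrite mulr_gt0// !exprn_gt0.
have M1 : 1 <= M ^+ k by rewrite exprn_ege1// exprn_ege1// ler1n.
have h0E : 18 * (n%:R * h0) = 1 by rewrite /h0; field; exact: lt0r_neq0.
have h01 : 0 < h0 by rewrite invr_gt0 mulr_gt0.
have h0n : h0 <= n%:R * h0 by rewrite ler_peMl// ltW.
have a0 := normr_ge0 a.
have s1 : s <= 1 by lra.
have BS y : enorm2 (y - a) <= 64 * n%:R * s ^+ 2 -> S y.
  move=> ya.
  have : `|y - a| <= 8 * (n%:R * s).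
    rewrite -(@ler_pXn2r _ 2) ?nnegrE ?mulr_ge0 ?(ltW s0)//.
    apply: le_trans (norm_sqr_le_enorm2 _) _; apply: le_trans ya _.
    have -> : (8 * (n%:R * s)) ^+ 2 = 64 * n%:R * s ^+ 2 * n%:R by ring.
    by rewrite ler_peMr// !mulr_ge0// ltW.
  have : n%:R * s <= n%:R * h0 by rewrite ler_pM2l//; lra.
  have := ler_normD (y - a) a; rewrite subrK /S /= => y1 y2 y3.
  have : n%:R * (`|a| + s) <= n%:R * h0 by rewrite ler_pM2l.
  have : `|a| <= n%:R * `|a| by rewrite ler_peMl.
  have := mulr_gt0 n0 s0; lra.
have /(@density_growth R n lam Lam m a s (M ^+ k * t0) v Hv A n_gt0 lam_gt0 Lam_gt0 s0 t1 m_large) := C0_large.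
have vc : {within [set x0 | enorm2 (x0 - a) <= 64 * n%:R * s ^+ 2], continuous v}.
  by apply: continuous_subspaceW v_cont => y; exact: BS.
have vh y : enorm2 (y - a) <= 64 * n%:R * s ^+ 2 -> forall e : R, 0 < e -> exists d : R, 0 < d /\
  forall z, enorm2 (y + z - a) <= 64 * n%:R * s ^+ 2 ->
    enorm2 (y - z - a) <= 64 * n%:R * s ^+ 2 -> `|z| <= d ->
  `|sd v y z - qf (Hv y) z| <= e * enorm2 z.
  move=> yB e e0; have [d [d0 H]] := v_hess (BS y yB) e0; exists d; split=> // z z1 z2.
  by apply: H; exact: BS.
move=> /(_ (fun y yB => v_ge0 (BS y yB)) vc vh (fun y yB => Hv_sym (BS y yB))
  (fun y yB => A_ell (BS y yB)) (fun y yB => v_super (BS y yB)) j x) H.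
have {}H := H _ xa vx.
have : density_bound R n C0 <= dens (fun (a : 'rV_n) (s : R) =>
    `[< exists x, `|x - a| <= s /\ v x <= 2 ^+ m.+3 * (M ^+ k * t0) >]) j a s.
  apply: H => y z By Bp Bm zs.
  have := v_small (BS _ By) (BS _ Bp) (BS _ Bm); rewrite -sE => /(_ zs).
  (* As [s <= 1] and [M >= 1], the error allowed here, [M ^+ k * t0 / s ^+ 2], is at least the [t0]
     of [v_small]. *)
  move=> /le_trans; apply; rewrite lerD2l ler_wpM2r ?enorm2_ge0//.
  rewrite ler_pdivlMr ?exprn_gt0//.
  apply: le_trans (_ : t0 * 1 <= _).
    by rewrite ler_pM2l// exprn_ile1// ltW.
  by rewrite mulr1 ler_peMl// ltW.
rewrite -/mu => mud.
rewrite -(_ : dens (fun a s => ~~ ~~ above k.+1 a s) j a s = dens (above k.+1) j a s); last first.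
  by apply/eqP; rewrite eq_le; apply/andP; split; apply: dens_mono => ? ?; rewrite negbK.
rewrite densC lerD2l lerN2; apply: le_trans mud _.
apply: dens_mono => b r /asboolP[y [yb vy]]; apply/asboolP => /(_ y yb).
by rewrite exprS -mulrA -/M ltNge vy.
Qed.

Lemma density_bound_gt0 : 0 < mu.
Proof. by rewrite invr_gt0 ltr0n expn_gt0 !muln_gt0 n_gt0. Qed.

Lemma density_bound_le1 : mu <= 1.
Proof.
rewrite invf_le1 ?ler1n ?ltr0n expn_gt0 !muln_gt0 n_gt0//.
Qed.

(** [calderon_zygmund] compares two consecutive levels: raising the level by the factor [M] costs a
    factor [1 - mu] in density, whatever [J] is. *)
Lemma weak_harnack (x : 'rV[R]_n) k : `|x| <= h0 -> v x <= t0 ->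
  dens (above k) J 0 h0 <= (1 - mu) ^+ k.
Proof.
move=> xh vx.
have n0 : 0 < n%:R :> R by rewrite ltr0n.
have h01 : 0 < h0 by rewrite invr_gt0 mulr_gt0.
have mu0 := density_bound_gt0; have mu1 := density_bound_le1.
elim: k => [|k IH].
  rewrite expr0; have := dens_ge0 (fun a s => ~~ above 0 a s) J 0 h0.
  by rewrite densC subr_ge0.
have top : dens (above k.+1) J 0 h0 <= 1 - mu.
  apply: (@density_above k J 0 x h0) => //.
  - by rewrite normr0 add0r.
  - by rewrite subr0; lra.
  - by apply: le_trans vx _; rewrite ler_peMl ?(ltW t0_gt0)// exprn_ege1// exprn_ege1// ler1n.
apply: le_trans (_ : (1 - mu) * dens (above k) J 0 h0 <= _); last first.
  by rewrite exprS ler_wpM2l// subr_ge0.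
apply: calderon_zygmund => //; [by apply/andP; split; lra|exact: ltW|].
(* Contrapositive of [density_above] in the child: the whole parent lies within [3 * (s / 2)] of the
   child's centre, which is the origin of the factor 3. *)
move=> j a s b jJ s0' as_ sE db.
have s0 : 0 < s.
  have : 0 < s / 2 ^+ j.+1 by rewrite sE divr_gt0// exprn_gt0.
  by rewrite pmulr_lgt0// invr_gt0 exprn_gt0.
rewrite subr0 in as_.
have all_above y : `|y - a| <= s -> M ^+ k * t0 < v y.
  move=> ya; rewrite ltNge; apply/negP => vy; move: db; apply/negP; rewrite -leNgt.
  have ca := child_dist a b s0'.
  apply: (@density_above k j (child a s b) y (s / 2)) => //.
  - by rewrite divr_gt0.
  - have := ler_normD (child a s b - a) a; rewrite subrK; lra.
  - by rewrite -sE exprS invfM mulrA.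
  - rewrite -(subrKA a); apply: le_trans (ler_normD _ _) _.
    by rewrite (distrC a); lra.
apply: dens_eq1 => // a' a'a; apply/asboolP => y ya; apply: all_above.
rewrite -(subrKA a'); apply: le_trans (ler_normD _ _) _; lra.
Qed.

End WeakHarnack.


(** * Geometric decay and finite colourings *)

Lemma geometric_small (R : realType) (mu e : R) : 0 < mu <= 1 -> 0 < e ->
  exists k, (1 - mu) ^+ k < e.
Proof.
move=> /andP[mu0 mu1] e0.
have bern k : (1 - mu) ^+ k * (1 + k%:R * mu) <= 1.
  elim: k => [|k IH]; first by rewrite expr0 mul0r addr0 mulr1.
  have k0 : 0 <= k%:R :> R by exact: ler0n.
  have q0 : 0 <= (1 - mu) ^+ k by rewrite exprn_ge0// subr_ge0.
  apply: le_trans IH; rewrite exprS (mulrC (1 - mu)) -mulrA ler_wpM2l//.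
  by rewrite -natr1; have := mulr_ge0 k0 (sqr_ge0 mu); have := sqr_ge0 mu; lra.
pose k := (Num.trunc (e^-1 / mu)).+1; exists k.
have kl : e^-1 < k%:R * mu by rewrite -ltr_pdivrMr// truncnS_gt.
have p1 : 0 < 1 + k%:R * mu.
  by have := mulr_ge0 (ler0n R k) (ltW mu0); lra.
rewrite -(ltr_pM2r p1); apply: le_lt_trans (bern k) _.
rewrite -ltr_pdivrMl// mulr1; lra.
Qed.

Lemma pow2_unbounded (R : realType) (x : R) : exists J, x <= 2 ^+ J.
Proof.
exists (Num.trunc x).+1; apply: le_trans (ltW (truncnS_gt x)) _.
by rewrite -natrX ler_nat ltnW// ltn_expl.
Qed.

Section Coloring.
Variables (R : realType) (n : nat).

(** Colours are the entries rounded down to multiples of [1 / L]. Offsets from [H c] fill an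
    interval of length 2, hence [2 L + 1] values per entry. *)
Lemma finite_coloring (L : nat) (D : set 'rV[R]_n) (H : 'rV[R]_n -> 'M[R]_n) c :
  (forall x i j, D x -> `|H x i j - H c i j| <= 1) ->
  exists col : 'rV[R]_n -> {ffun 'I_n * 'I_n -> 'I_L.*2.+1},
    forall x y, D x -> D y -> col x = col y ->
    forall i j, `|H x i j - H y i j| * L%:R <= 1.
Proof.
move=> osc; pose val x i j := (H x i j - H c i j + 1) * L%:R.
have val0 x i j : D x -> 0 <= val x i j.
  move=> Dx; rewrite mulr_ge0//; have := osc x i j Dx; rewrite ler_norml; lra.
have val2 x i j : D x -> (Num.trunc (val x i j) < L.*2.+1)%N.
  move=> Dx; rewrite truncn_lt_nat ?val0//.
  have : H x i j - H c i j + 1 <= 2 by have := osc x i j Dx; rewrite ler_norml; lra.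
  move=> /(ler_wpM2r (ler0n R L)) /le_lt_trans; apply.
  by rewrite -natrM ltr_nat ltnS mul2n.
exists (fun x => [ffun p => inord (Num.trunc (val x p.1 p.2))]) => x y Dx Dy.
move=> /ffunP E i j; have := congr1 (@nat_of_ord _) (E (i, j)).
rewrite !ffunE /= !inordK ?val2// => Et.
have /andP[x1 x2] := truncn_itv (val0 x i j Dx).
have /andP[y1 y2] := truncn_itv (val0 y i j Dy).
rewrite Et in x1 x2; rewrite -natr1 in x2 y2.
have -> : `|H x i j - H y i j| * L%:R = `|val x i j - val y i j|.
  have -> : val x i j - val y i j = (H x i j - H y i j) * L%:R by rewrite /val; ring.
  by rewrite normrM [X in _ = _ * X]ger0_norm.
rewrite ler_norml; lra.
Qed.

End Coloring.

(** * Loss of a Hessian value on a smaller cube *)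

Section EvansKrylov.
Variables (R : realType) (n : nat) (lam Lam : R).
Hypotheses (n_gt0 : (0 < n)%N) (lam_gt0 : 0 < lam) (Lam_gt0 : 0 < Lam).

(* [H] is the Hessian of [u]; [A x] is the inner normal to the convex set
   {F >= 0} at [H x], so that [H y] lies on its positive side. *)
Record ek_data (c : 'rV[R]_n) (r : R) (u : 'rV[R]_n -> R)
    (H A : 'rV[R]_n -> 'M[R]_n) : Prop := {
  ek_ucont : ucont [set x | `|x - c| <= r] u;
  ek_hess_ucont : forall e : R, 0 < e -> exists d : R, 0 < d /\
    forall x y, `|x - c| <= r -> `|y - c| <= r -> `|x - y| <= d ->
    forall i j, `|H x i j - H y i j| <= e;
  ek_hess : forall e : R, 0 < e -> exists d : R, 0 < d /\
    forall x z, `|x - c| <= r -> `|x + z - c| <= r -> `|x - z - c| <= r ->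
    `|z| <= d -> `|sd u x z - qf (H x) z| <= e * enorm2 z;
  ek_sym : forall x, `|x - c| <= r -> (H x)^T = H x;
  ek_ell : forall x, `|x - c| <= r -> elliptic lam Lam (A x);
  ek_convex : forall x y, `|x - c| <= r -> `|y - c| <= r ->
    0 <= ip (A x) (H y - H x) }.

Lemma qf_entries_dist (M N : 'M[R]_n) (e : 'rV[R]_n) (a : R) :
  enorm2 e = 1 -> (forall i j, `|M i j - N i j| <= a) ->
  `|qf M e - qf N e| <= a * n%:R.
Proof.
move=> e1 MN; have := @qf_le_entries R n (M - N) a e.
by rewrite qfB e1 mulr1; apply => i j; rewrite !mxE.
Qed.

Lemma unit_norm (e : 'rV[R]_n) : enorm2 e = 1 -> `|e| <= 1.
Proof.
move=> e1; rewrite -(@ler_pXn2r _ 2) ?nnegrE// expr1n.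
by rewrite -[leRHS]e1; exact: norm_sqr_le_enorm2.
Qed.

Lemma exists_constants : exists m C0 : nat,
  32 * n%:R ^+ 2 * Lam < m.+1%:R * lam
  /\ 8 * n%:R * opening n lam Lam m <= C0%:R.
Proof.
exists (Num.trunc (32 * n%:R ^+ 2 * Lam / lam)).
eexists; split; first by rewrite -ltr_pdivrMr// truncnS_gt.
exact/ltW/truncnS_gt.
Qed.

(* A Hessian value attained where some pure second derivative is nearly
   maximal is no longer attained in a smaller cube. *)
Lemma hessian_value_lost : exists eps theta : R, [/\ 0 < eps, 0 < theta <= 2^-1 &
  forall u H A, ek_data 0 1 u H A ->
  (forall x y i j, `|x| <= 1 -> `|y| <= 1 -> `|H x i j - H y i j| <= 1) ->
  (exists x y i j, [/\ `|x| <= 1, `|y| <= 1 & 2^-1 < `|H x i j - H y i j|]) ->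
  exists2 x', `|x'| <= 1 &
    forall x, `|x| <= theta -> exists i j, eps < `|H x i j - H x' i j|].
Proof.
have [m [C0 [m_large C0_large]]] := exists_constants.
have n1 : 1 <= n%:R :> R by rewrite ler1n.
have n0 : 0 < n%:R :> R by rewrite ltr0n.
(* [q] is the constant of [elliptic_positive_direction], and [c0] the gain in some pure second
   derivative forced by an entry larger than [1/4]. *)
pose q := 1 + n%:R * Lam / lam.
have q0 : 0 < q by rewrite addr_gt0// divr_gt0// mulr_gt0.
pose c0 := (8 * q)^-1.
have c00 : 0 < c0 by rewrite invr_gt0 mulr_gt0.
have c0q : c0 * q = 8^-1 by rewrite /c0; field; exact: lt0r_neq0.
(* Values of one colour then differ by at most [c0 / 4] in any unit direction. *)
pose L := (Num.trunc (4 * n%:R / c0)).+1.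
have L0 : 0 < L%:R :> R by rewrite ltr0n.
have Ln : n%:R / L%:R <= c0 / 4.
  rewrite ler_pdivrMr// mulrC mulrA ler_pdivlMr//.
  have := ltW (truncnS_gt (4 * n%:R / c0)); rewrite -/L ler_pdivrMr//; lra.
pose N0 : R := #|{ffun 'I_n * 'I_n -> 'I_L.*2.+1}|%:R.
have N00 : 0 < N0 by rewrite ltr0n; apply/card_gt0P; exists [ffun=> ord0].
pose mu : R := density_bound R n C0.
have mu0 : 0 < mu := density_bound_gt0 R C0 n_gt0.
have mu1 : mu <= 1 := density_bound_le1 R C0 n_gt0.
(* After [k] levels the density of high cells is below the share [1 / N0] of a popular colour; [t0]
   is chosen so that the top level is [c0 / 4]. *)
have [|k kN] := @geometric_small R mu N0^-1 _ ltac:(by rewrite invr_gt0).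
  by rewrite mu0.
pose M : R := 2 ^+ m.+3.
have Mk : 0 < M ^+ k by rewrite !exprn_gt0.
pose t0 := c0 / (4 * M ^+ k).
have t00 : 0 < t0 by rewrite divr_gt0// mulr_gt0.
have Mt0 : M ^+ k * t0 = c0 / 4 by rewrite /t0; field; exact: lt0r_neq0.
(* Three errors of size [t0 / 4] will enter [v x0]: one through [eps], two through [tau]. *)
pose eps := t0 / (4 * n%:R); have eps0 : 0 < eps by rewrite divr_gt0// mulr_gt0.
have epsn : eps * n%:R = t0 / 4 by rewrite /eps; field; exact: lt0r_neq0.
pose tau := t0 / 4; have tau0 : 0 < tau by rewrite divr_gt0.
pose h0 : R := (18 * n%:R)^-1.
have h01 : 0 < h0 by rewrite invr_gt0 mulr_gt0.
have h0E : 18 * (n%:R * h0) = 1 by rewrite /h0; field; exact: lt0r_neq0.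
have h0n : h0 <= n%:R * h0 by rewrite ler_peMl// ltW.
have h0h : h0 <= 2^-1 by lra.
exists eps, h0; split=> //; first by rewrite h01.
move=> u H A ek osc1 osc2; apply: contrapT => no.
have close x' : `|x'| <= 1 ->
    exists2 x, `|x| <= h0 & forall i j, `|H x i j - H x' i j| <= eps.
  move=> x'1; apply: contrapT => no'; apply: no; exists x' => // x xh.
  apply: contrapT => no2; apply: no'; exists x => // i j.
  by rewrite leNgt; apply/negP => ?; apply: no2; exists i, j.
have [uc Hc Hh Hs Ae Ac] := ek.
have {}Hc e : 0 < e -> exists d : R, 0 < d /\
    forall x y, `|x| <= 1 -> `|y| <= 1 -> `|x - y| <= d ->
    forall i j, `|H x i j - H y i j| <= e.
  move=> /Hc[d [d0 Hd]]; exists d; split=> // x y.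
  by have := Hd x y; rewrite !subr0.
have {}Hh e : 0 < e -> exists d : R, 0 < d /\
    forall x z, `|x| <= 1 -> `|x + z| <= 1 -> `|x - z| <= 1 ->
    `|z| <= d -> `|sd u x z - qf (H x) z| <= e * enorm2 z.
  move=> /Hh[d [d0 Hd]]; exists d; split=> // x z.
  by have := Hd x z; rewrite !subr0.
have {}Hs x : `|x| <= 1 -> (H x)^T = H x by move=> x1; apply: Hs; rewrite subr0.
have {}Ae x : `|x| <= 1 -> elliptic lam Lam (A x) by move=> x1; apply: Ae; rewrite subr0.
have {}Ac x y : `|x| <= 1 -> `|y| <= 1 -> 0 <= ip (A x) (H y - H x).
  by move=> x1 y1; apply: Ac; rewrite subr0.
have [d1 [d10 Hd1]] := Hh _ tau0.
pose hh := Num.min d1 2^-1.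
have hh0 : 0 < hh by rewrite lt_min d10 /= invr_gt0 ltr0n.
have hhd : hh <= d1 by rewrite ge_min lexx.
have hh2 : hh <= 2^-1 by rewrite ge_min lexx orbT.
have hhs : 0 < hh ^+ 2 by rewrite exprn_gt0.
have e'0 : 0 < hh ^+ 2 * t0 / 4 by rewrite divr_gt0// mulr_gt0.
have [d2 [d20 Hd2]] := Hh _ e'0.
have om0 : 0 < c0 / (8 * n%:R) by rewrite divr_gt0// mulr_gt0.
have [d3 [d30 Hd3]] := Hc _ om0.
have [J HJ] := pow2_unbounded (4 * h0 / d2 + h0 / d3).
have p2J : 0 < 2 ^+ J :> R by rewrite exprn_gt0.
have J2 : 4 * (h0 / 2 ^+ J) <= d2.
  rewrite mulrA ler_pdivrMr// (mulrC d2) -ler_pdivrMr//; apply: le_trans HJ.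
  by rewrite lerDl divr_ge0// ltW.
have J3 : h0 / 2 ^+ J <= d3.
  rewrite ler_pdivrMr// (mulrC d3) -ler_pdivrMr//; apply: le_trans HJ.
  by rewrite lerDr divr_ge0 ?mulr_ge0// ltW.
have [col Hcol] := @finite_coloring R n L [set x | `|x| <= 1] H 0
   (fun x i j x1 => osc1 x 0 i j x1 ltac:(by rewrite normr0)).
have [i pop] : exists i, N0^-1 <= dens (fun a _ => col a == i) J 0 h0.
  apply: contrapT => nopop.
  have := @dens_sum R n _ (fun i a _ => col a == i) J 0 h0
    (fun a _ => ex_intro _ (col a) (eqxx _)).
  apply/negP; rewrite -ltNge.
  have -> : 1 = \sum_(i : {ffun 'I_n * 'I_n -> 'I_L.*2.+1}) N0^-1.
    by rewrite sumr_const -mulr_natl mulfV// lt0r_neq0.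
  apply: ltr_sum => [|i _].
    by apply/hasP; exists [ffun=> ord0] => //; rewrite mem_index_enum.
  by rewrite ltNge; apply/negP => ?; apply: nopop; exists i.
have N0V : 0 < N0^-1 by rewrite invr_gt0.
have [x1 [x1h /eqP x1c]] := dens_gt0_ex (ltW h01) (lt_le_trans N0V pop).
have eta0 : 0 < h0 / 2 ^+ J by rewrite divr_gt0.
rewrite subr0 in x1h.
have x11 : `|x1| <= 1 by move: x1h eta0 h0h; clear -n_gt0 lam_gt0 Lam_gt0; lra.
(* Two values more than [1/2] apart in an entry cannot both be within [1/4] of [H x1]. *)
have [x2 [i1 [j1 [x21 x2H]]]] : exists x2 i j, `|x2| <= 1 /\ 4^-1 < `|(H x2 - H x1) i j|.
  have [x [y [i1 [j1 [xx yy xy]]]]] := osc2.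
  have T := ler_normD (H x i1 j1 - H x1 i1 j1) (H x1 i1 j1 - H y i1 j1).
  rewrite subrKA in T.
  have [xl|xg] := leP (`|H x i1 j1 - H x1 i1 j1|) 4^-1; last first.
    by exists x, i1, j1; rewrite !mxE.
  exists y, i1, j1; rewrite !mxE distrC; split=> //; move: T xl xy; clear -n_gt0 lam_gt0 Lam_gt0; lra.
have Ns : (H x2 - H x1)^T = H x2 - H x1 by rewrite raddfB /= !Hs.
have c0x : c0 * (1 + n%:R * Lam / lam) < `|(H x2 - H x1) i1 j1|.
  by rewrite -/q c0q; apply: lt_trans x2H; clear -n_gt0 lam_gt0 Lam_gt0; lra.
have [e [e1 eN]] := elliptic_positive_direction lam_gt0 (Ae _ x11) Ns (Ac _ _ x11 x21) c00 c0x.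
rewrite qfB in eN.
have qc : {within [set x : 'rV[R]_n | `|x - 0| <= 1], continuous (fun x => qf (H x) e)}.
  apply: ucont_within => b b0.
  have bn : 0 < b / n%:R by rewrite divr_gt0.
  have [d [d0 Hd]] := Hc _ bn; exists d; split=> // x y /=; rewrite !subr0 => xx yy xy.
  have := qf_entries_dist e1 (Hd x y xx yy xy).
  by rewrite divfK// lt0r_neq0.
have [x3 x3D x3max] : exists2 x3, x3 \in [set x : 'rV[R]_n | `|x - 0| <= 1] &
   forall y, y \in [set x : 'rV[R]_n | `|x - 0| <= 1] -> qf (H y) e <= qf (H x3) e.
  apply: compact_EVT_max qc; last exact: compact_cube.
  by exists 0; rewrite /= subr0 normr0.
rewrite inE /= subr0 in x3D.
have {}x3max y : `|y| <= 1 -> qf (H y) e <= qf (H x3) e.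
  by move=> y1; apply: x3max; rewrite inE /= subr0.
(* Under the assumption to be refuted, the value at the maximum point [x3] is nearly taken in the
   small cube. *)
have [x0 x0h x0c] := close _ x3D.
pose he := hh *: e.
have hen : `|he| <= hh.
  rewrite normrZ gtr0_norm// ler_piMr ?(ltW hh0)//; exact: unit_norm.
have heE : enorm2 he = hh ^+ 2 by rewrite enorm2Z e1 mulr1.
pose K := qf (H x3) e.
(* [tau] absorbs the gap between the quotient and the second derivative, so that [v >= 0]. [Hv] is
   the matching Hessian, and [ek_convex] at [x] gives the supersolution inequality. *)
pose v x := K + tau - sd u x he / hh ^+ 2.
pose Hv x := - (hh ^+ 2)^-1 *: ((H (x + he) - H x) + (H (x - he) - H x)).
have shift x (z : 'rV[R]_n) : `|x| <= 2^-1 -> `|z| <= hh -> `|x + z| <= 1.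
  by move=> x1' z1; apply: le_trans (ler_normD _ _) _; move: x1' z1 hh2; clear -n_gt0 lam_gt0 Lam_gt0; lra.
have half1 (x : 'rV[R]_n) : `|x| <= 2^-1 -> `|x| <= 1 by move=> xh; apply: le_trans xh _; clear -n_gt0 lam_gt0 Lam_gt0; lra.
have henN : `|- he| <= hh by rewrite normrN.
have sdu x : `|x| <= 2^-1 -> `|sd u x he / hh ^+ 2 - qf (H x) e| <= tau.
  move=> xh; have := Hd1 x he (half1 _ xh) (shift _ _ xh hen) (shift _ _ xh henN) (le_trans hen hhd).
  rewrite /he qfZv -/he heE.
  have -> : sd u x he / hh ^+ 2 - qf (H x) e = (sd u x he - hh ^+ 2 * qf (H x) e) / hh ^+ 2.
    by field; exact: lt0r_neq0.
  by rewrite normrM [X in _ * X <= _]gtr0_norm ?invr_gt0// ler_pdivrMr.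
have sdv x z : sd v x z = - (sd u (x + he) z + sd u (x - he) z - 2 * sd u x z) / hh ^+ 2.
  rewrite /sd /v /sd (addrAC x z he) (addrAC x z (- he)) (addrAC x (- z) he) (addrAC x (- z) (- he)).
  by field; exact: lt0r_neq0.
have qHv x z : qf (Hv x) z
   = - (qf (H (x + he)) z + qf (H (x - he)) z - 2 * qf (H x) z) / hh ^+ 2.
  by rewrite /Hv qfZ qfD !qfB; field; exact: lt0r_neq0.
have vT (b d : R) : (forall x z, `|x| <= 1 -> `|x + z| <= 1 -> `|x - z| <= 1 ->
      `|z| <= d -> `|sd u x z - qf (H x) z| <= hh ^+ 2 * b / 4 * enorm2 z) ->
    forall x z, `|x| <= 2^-1 -> `|x + z| <= 2^-1 -> `|x - z| <= 2^-1 -> `|z| <= d ->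
      `|sd v x z - qf (Hv x) z| <= b * enorm2 z.
  move=> Hd x z xh xp xm zd.
  have T1 := Hd x z (half1 _ xh) (half1 _ xp) (half1 _ xm) zd.
  have T2 : `|sd u (x + he) z - qf (H (x + he)) z| <= hh ^+ 2 * b / 4 * enorm2 z.
    by apply: Hd; rewrite ?(addrAC x he) ?shift.
  have T3 : `|sd u (x - he) z - qf (H (x - he)) z| <= hh ^+ 2 * b / 4 * enorm2 z.
    by apply: Hd; rewrite ?(addrAC x (- he)) ?shift.
  rewrite sdv qHv -mulrBl normrM [X in _ * X]gtr0_norm ?invr_gt0// ler_pdivrMr//.
  move: T1 T2 T3; rewrite !ler_norml; clear -n_gt0 lam_gt0 Lam_gt0; lra.
have := @weak_harnack R n lam Lam m C0 v Hv A t0 J n_gt0 lam_gt0 Lam_gt0 m_large C0_large t00.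
move=> /(_ _ _ _ _ _ _ _ x0 k x0h) wh.
have vge x : `|x| <= 2^-1 -> 0 <= v x.
  move=> xh; have := sdu x xh; have := x3max x (half1 _ xh).
  by rewrite ler_norml /v /K; clear -n_gt0 lam_gt0 Lam_gt0; lra.
have vcont : {within [set x : 'rV[R]_n | `|x| <= 2^-1], continuous v}.
  apply: ucont_within => b b0.
  have b4 : 0 < b * hh ^+ 2 / 4 by rewrite divr_gt0// mulr_gt0.
  have [d [d0 Hd]] := uc _ b4; exists d; split=> // x y xx yy xy.
  have ud (z : 'rV[R]_n) : `|z| <= hh -> `|u (x + z) - u (y + z)| <= b * hh ^+ 2 / 4.
    move=> zh; apply: Hd; rewrite /= ?subr0 ?shift//.
    by rewrite opprD addrACA subrr addr0.
  have U1 := ud he hen; have U2 := ud (- he) henN.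
  have U3 := ud 0 ltac:(by rewrite normr0 ltW); rewrite !addr0 in U3.
  have -> : v x - v y = (sd u y he - sd u x he) / hh ^+ 2 by rewrite /v; ring.
  rewrite normrM [X in _ * X]gtr0_norm ?invr_gt0// ler_pdivrMr//.
  by rewrite /sd; move: U1 U2 U3; rewrite !ler_norml; clear -n_gt0 lam_gt0 Lam_gt0; lra.
have vh x : `|x| <= 2^-1 -> forall b : R, 0 < b -> exists d : R, 0 < d /\
    forall z, `|x + z| <= 2^-1 -> `|x - z| <= 2^-1 -> `|z| <= d ->
    `|sd v x z - qf (Hv x) z| <= b * enorm2 z.
  move=> xh b b0; have b4 : 0 < hh ^+ 2 * b / 4 by rewrite divr_gt0// mulr_gt0.
  have [d [d0 Hd]] := Hh _ b4; exists d; split=> // z zp zm zd.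
  exact: (vT b d Hd).
have vsmall x z : `|x| <= 2^-1 -> `|x + z| <= 2^-1 -> `|x - z| <= 2^-1 ->
    `|z| <= 4 * (h0 / 2 ^+ J) -> sd v x z <= qf (Hv x) z + t0 * enorm2 z.
  move=> xh xp xm zs; have := vT t0 d2 Hd2 x z xh xp xm (le_trans zs J2).
  by rewrite ler_norml; clear -n_gt0 lam_gt0 Lam_gt0; lra.
have Hvs x : `|x| <= 2^-1 -> (Hv x)^T = Hv x.
  move=> xh; rewrite /Hv linearZ /= raddfD /= !raddfB /= !Hs ?shift//.
  exact: half1.
have vsup x : `|x| <= 2^-1 -> ip (A x) (Hv x) <= 0.
  move=> xh; rewrite /Hv ipZr ipDr mulNr oppr_le0 mulr_ge0 ?invr_ge0 ?(ltW hhs)//.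
  by rewrite addr_ge0// Ac ?shift ?half1.
have vx0 : v x0 <= t0.
  have x0h' := le_trans x0h h0h.
  have := sdu x0 x0h'; have := qf_entries_dist e1 x0c.
  by rewrite epsn !ler_norml /v /K /tau; move: t00; clear -n_gt0 lam_gt0 Lam_gt0; lra.
have := wh vge vcont vh vsmall Hvs (fun x xh => Ae x (half1 x xh)) vsup vx0.
apply/negP; rewrite -ltNge; apply: lt_le_trans kN _; apply: le_trans pop _.
(* On a cell whose centre has the popular colour, [v] is at least [c0 - c0 / 8 - c0 / 4]: the gain
   at [x2] over [x1], less the variation within the cell and within the colour. This exceeds the top
   level, so popular cells are high cells. *)
apply: dens_mono_in (ltW h01) _ => a; rewrite subr0 => ah /eqP ac.
apply/asboolP => x xa; rewrite -/M Mt0.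
have xh : `|x| <= 2^-1.
  by have := ler_normD (x - a) a; rewrite subrK; move: xa ah h0h; clear -n_gt0 lam_gt0 Lam_gt0; lra.
have a1 : `|a| <= 1 by have := normr_ge0 (x - a); move: xa ah h0h; clear -n_gt0 lam_gt0 Lam_gt0; lra.
have E1 : `|qf (H x) e - qf (H a) e| <= c0 / (8 * n%:R) * n%:R.
  by apply: qf_entries_dist e1 _ => i2 j2; apply: Hd3 => //; [exact: half1|exact: le_trans xa J3].
have E2 : `|qf (H a) e - qf (H x1) e| <= L%:R^-1 * n%:R.
  apply: qf_entries_dist e1 _ => i2 j2.
  by rewrite -[leRHS]mul1r ler_pdivlMr//; apply: Hcol => //; rewrite ac x1c.
have E1n : c0 / (8 * n%:R) * n%:R = c0 / 8 by field; exact: lt0r_neq0.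
rewrite E1n in E1; rewrite mulrC in E2.
have := sdu x xh; have := x3max x2 x21.
move: E1 E2 Ln eN c00; rewrite !ler_norml /v -/K; clear -n_gt0 lam_gt0 Lam_gt0; lra.
Qed.

End EvansKrylov.


(** * Scaling, oscillation decay and the Holder exponent *)

Section OscillationDecay.
Variables (R : realType) (n : nat) (lam Lam : R).
Hypotheses (n_gt0 : (0 < n)%N) (lam_gt0 : 0 < lam) (Lam_gt0 : 0 < Lam).
Implicit Types (u : 'rV[R]_n -> R) (H A : 'rV[R]_n -> 'M[R]_n).

Lemma ek_data_sub c r c' r' u H A : `|c' - c| + r' <= r ->
  ek_data lam Lam c r u H A -> ek_data lam Lam c' r' u H A.
Proof.
move=> cr [uc Hc Hh Hs Ae Ac].
have sub x : `|x - c'| <= r' -> `|x - c| <= r.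
  move=> xc; rewrite -(subrKA c'); apply: le_trans (ler_normD _ _) _; lra.
split=> [e e0|e e0|e e0|x /sub|x /sub|x y /sub xr /sub]; last 3 first.
- exact: Hs.
- exact: Ae.
- exact: Ac.
- have [d [d0 Hd]] := uc e e0; exists d; split=> // x y /sub xr /sub; exact: Hd.
- have [d [d0 Hd]] := Hc e e0; exists d; split=> // x y /sub xr /sub; exact: Hd.
- have [d [d0 Hd]] := Hh e e0; exists d; split=> // x z /sub xr /sub zr /sub; exact: Hd.
Qed.

(** Division by [r ^+ 2] compensates the change of variable in the Hessian, and [w] normalises its
    oscillation. The convexity inequality is homogeneous in the Hessian, so the normals keep their
    values. *)
Lemma ek_data_scale c r w u H A : 0 < r -> 0 < w ->
  ek_data lam Lam c r u H A ->
  ek_data lam Lam 0 1 (fun x => u (c + r *: x) / (r ^+ 2 * w))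
    (fun x => w^-1 *: H (c + r *: x)) (fun x => A (c + r *: x)).
Proof.
move=> r0 w0 [uc Hc Hh Hs Ae Ac].
have nE (x : 'rV[R]_n) : `|r *: x| = r * `|x| by rewrite normrZ gtr0_norm.
have dE (x y : 'rV[R]_n) : c + r *: x - (c + r *: y) = r *: (x - y).
  by rewrite opprD addrACA subrr add0r scalerBr.
have sub (x : 'rV[R]_n) : `|x - 0| <= 1 -> `|c + r *: x - c| <= r.
  by rewrite subr0 addrAC subrr add0r nE => ?; rewrite ler_piMr// ltW.
have rw : 0 < r ^+ 2 * w by rewrite mulr_gt0// exprn_gt0.
split=> [e e0|e e0|e e0|x /sub|x /sub|x y /sub xr /sub].
- have ew : 0 < e * (r ^+ 2 * w) by rewrite mulr_gt0.
  have [d [d0 Hd]] := uc _ ew; exists (d / r); split; first by rewrite divr_gt0.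
  move=> x y /= /sub xr /sub yr; rewrite ler_pdivlMr// mulrC => xy.
  rewrite -mulrBl normrM [X in _ * X]gtr0_norm ?invr_gt0// ler_pdivrMr//.
  by apply: Hd => //; rewrite dE nE.
- have ew : 0 < e * w by rewrite mulr_gt0.
  have [d [d0 Hd]] := Hc _ ew; exists (d / r); split; first by rewrite divr_gt0.
  move=> x y /= /sub xr /sub yr; rewrite ler_pdivlMr// mulrC => xy i j.
  rewrite !mxE -mulrBr normrM gtr0_norm ?invr_gt0// mulrC ler_pdivrMr//.
  by apply: Hd => //; rewrite dE nE.
- have ew : 0 < e * w by rewrite mulr_gt0.
  have [d [d0 Hd]] := Hh _ ew; exists (d / r); split; first by rewrite divr_gt0.
  move=> x z /= /sub xr /sub pr /sub mr; rewrite ler_pdivlMr// mulrC -nE => zd.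
  rewrite scalerDr addrA in pr; rewrite scalerBr addrA in mr.
  have := Hd _ _ xr pr mr zd; rewrite qfZv enorm2Z => T.
  have -> : sd (fun x => u (c + r *: x) / (r ^+ 2 * w)) x z
      = sd u (c + r *: x) (r *: z) / (r ^+ 2 * w).
    by rewrite /sd scalerDr scalerBr !addrA; ring.
  rewrite qfZ.
  have -> : sd u (c + r *: x) (r *: z) / (r ^+ 2 * w) - w^-1 * qf (H (c + r *: x)) z
     = (sd u (c + r *: x) (r *: z) - r ^+ 2 * qf (H (c + r *: x)) z) / (r ^+ 2 * w).
    by field; rewrite !lt0r_neq0.
  rewrite normrM [X in _ * X]gtr0_norm ?invr_gt0// ler_pdivrMr//.
  by apply: le_trans T _; rewrite le_eqVlt; apply/orP; left; apply/eqP; ring.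
- by move=> xr; rewrite linearZ /= Hs.
- exact: Ae.
- by move=> yr; rewrite -scalerBr ipZr mulr_ge0 ?invr_ge0 ?(ltW w0)// Ac.
Qed.

(* Each time the oscillation fails to halve, the smaller cube attains one
   colour less, so it must halve after as many steps as there are colours. *)
Lemma unit_oscillation_halves : exists theta : R, 0 < theta <= 2^-1 /\
  forall u H A, ek_data lam Lam 0 1 u H A ->
  (forall x y i j, `|x| <= 1 -> `|y| <= 1 -> `|H x i j - H y i j| <= 1) ->
  forall x y i j, `|x| <= theta -> `|y| <= theta -> `|H x i j - H y i j| <= 2^-1.
Proof.
have [eps [th [eps0 /andP[th0 th2] lost]]] := hessian_value_lost n_gt0 lam_gt0 Lam_gt0.
pose L := (Num.trunc eps^-1).+1.
have L0 : 0 < L%:R :> R by rewrite ltr0n.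
have Le : L%:R^-1 <= eps.
  by rewrite -(invrK eps) lef_pV2 ?posrE ?invr_gt0// ltW// truncnS_gt.
pose T : finType := {ffun 'I_n * 'I_n -> 'I_L.*2.+1}.
have T0 : (0 < #|T|)%N by apply/card_gt0P; exists [ffun=> ord0].
have th1 : th <= 1 by lra.
exists (th ^+ #|T|); split.
  rewrite exprn_gt0//=; case: #|T| T0 => // N _; rewrite exprS.
  by apply: le_trans th2; rewrite ler_piMr ?exprn_ile1// ltW.
move=> u H A ek osc.
have [col Hcol] := @finite_coloring R n L [set x | `|x| <= 1] H 0
   (fun x i j x1 => osc x 0 i j x1 ltac:(by rewrite normr0)).
pose halved (r : R) := forall x y i j, `|x| <= r -> `|y| <= r -> `|H x i j - H y i j| <= 2^-1.
pose seen (r : R) : {set T} :=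
  finset (fun a => `[< exists2 x, `|x| <= r & col x = a >]).
have thk k : 0 < th ^+ k <= 1 by rewrite exprn_gt0// exprn_ile1// ltW.
suff claim k : halved (th ^+ k) \/ (#|seen (th ^+ k)| + k <= #|T|)%N.
  (* After [#|T|] steps no colour would be left, yet the colour of the centre is always seen. *)
  have [//|] := claim #|T|; rewrite -[leqRHS]add0n leq_add2r leqn0 cards_eq0.
  move=> /eqP/setP/(_ (col 0)); rewrite finset.in_set finset.in_set0 => /asboolP[].
  by exists 0 => //; rewrite normr0 exprn_ge0// ltW.
elim: k => [|k [hk|hk]]; first by right; rewrite addn0 max_card.
  left=> x y i j xk yk; have le : th ^+ k.+1 <= th ^+ k.
    by rewrite exprS ler_piMl ?exprn_ge0// ltW.
  by apply: hk; [exact: le_trans le|exact: le_trans le].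
have [hd|nhd] := pselect (halved (th ^+ k)).
  left=> x y i j xk yk; have le : th ^+ k.+1 <= th ^+ k.
    by rewrite exprS ler_piMl ?exprn_ge0// ltW.
  by apply: hd; [exact: le_trans le|exact: le_trans le].
right; apply: leq_trans hk; rewrite addnS -addSn leq_add2r.
have /andP[r0 r1] := thk k; set r := th ^+ k in r0 r1 nhd *.
have ekr : ek_data lam Lam 0 1 (fun x => u (0 + r *: x) / (r ^+ 2 * 1))
    (fun x => 1^-1 *: H (0 + r *: x)) (fun x => A (0 + r *: x)).
  apply: ek_data_scale => //; apply: ek_data_sub ek; by rewrite subrr normr0 add0r.
have HE x i j : (1^-1 *: H (0 + r *: x)) i j = H (r *: x) i j.
  by rewrite add0r invr1 scale1r.
have nE (x : 'rV[R]_n) : `|r *: x| = r * `|x| by rewrite normrZ gtr0_norm.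
have in1 (x : 'rV[R]_n) : `|x| <= 1 -> `|r *: x| <= 1.
  by move=> x1; rewrite nE; apply: le_trans r1; rewrite ler_piMr// ltW.
have [||x' x'1 Hx'] := lost _ _ _ ekr.
- by move=> x y i j x1 y1; rewrite !HE; apply: osc; exact: in1.
- apply: contrapT => no; apply: nhd => x y i j xr yr.
  rewrite leNgt; apply/negP => big; apply: no.
  have sc (z : 'rV[R]_n) : r *: (r^-1 *: z) = z by rewrite scalerA mulfV ?scale1r// lt0r_neq0.
  have sn (z : 'rV[R]_n) : `|z| <= r -> `|r^-1 *: z| <= 1.
    by move=> zr; rewrite normrZ gtr0_norm ?invr_gt0// mulrC ler_pdivrMr// mul1r.
  by exists (r^-1 *: x), (r^-1 *: y), i, j; rewrite !HE !sc !sn.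
have rth : th ^+ k.+1 = th * r by rewrite exprS.
apply: proper_card; apply/properP; split.
  apply/fintype.subsetP => a; rewrite !finset.in_set => /asboolP[x xr <-]; apply/asboolP.
  by exists x => //; apply: le_trans xr _; rewrite rth ler_piMl// ltW.
(* A point of the smaller cube with the colour of the lost value would have all its entries within
   [1 / L <= eps] of it. *)
exists (col (r *: x')).
  by rewrite finset.in_set; apply/asboolP; exists (r *: x') => //; rewrite nE ler_piMr// ltW.
rewrite finset.in_set; apply/asboolPn => -[x xr cx].
have xth : `|r^-1 *: x| <= th.
  by rewrite normrZ gtr0_norm ?invr_gt0// mulrC ler_pdivrMr// -rth.
have [i [j]] := Hx' _ xth; rewrite !HE scalerA mulfV ?lt0r_neq0// scale1r.
apply/negP; rewrite -leNgt.
have xx1 : `|x| <= 1.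
  by apply: le_trans xr _; rewrite rth; apply: le_trans r1; rewrite ler_piMl ?(ltW r0).
have := Hcol x (r *: x') xx1 (in1 _ x'1) cx i j.
by rewrite -ler_pdivlMr// mul1r => /le_trans; apply.
Qed.

Lemma oscillation_halves : exists theta : R, 0 < theta <= 2^-1 /\
  forall c r w u H A, 0 < r -> 0 < w -> ek_data lam Lam c r u H A ->
  (forall x y i j, `|x - c| <= r -> `|y - c| <= r -> `|H x i j - H y i j| <= w) ->
  forall x y i j, `|x - c| <= theta * r -> `|y - c| <= theta * r ->
    `|H x i j - H y i j| <= w / 2.
Proof.
have [th [thb half]] := unit_oscillation_halves; exists th; split=> //.
move=> c r w u H A r0 w0 ek osc x y i j xr yr.
pose T (z : 'rV[R]_n) := r^-1 *: (z - c).
have TE z : c + r *: T z = z.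
  by rewrite /T scalerA mulfV ?lt0r_neq0// scale1r addrC subrK.
have TN (z : 'rV[R]_n) a : `|z - c| <= a * r -> `|T z| <= a.
  by move=> zr; rewrite normrZ gtr0_norm ?invr_gt0// mulrC ler_pdivrMr.
have wE (a b : 'M[R]_n) : `|(w^-1 *: a) i j - (w^-1 *: b) i j| = `|a i j - b i j| / w.
  by rewrite !mxE -mulrBr normrM gtr0_norm ?invr_gt0// mulrC.
have := half _ _ _ (ek_data_scale r0 w0 ek) _ (T x) (T y) i j (TN _ _ xr) (TN _ _ yr).
rewrite /= wE !TE ler_pdivrMr// [2^-1 * w]mulrC; apply=> x1 y1 i1 j1 x11 y11.
rewrite !mxE -mulrBr normrM gtr0_norm ?invr_gt0// mulrC ler_pdivrMr// mul1r.
have sub (z : 'rV[R]_n) : `|z| <= 1 -> `|c + r *: z - c| <= r.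
  by move=> z1; rewrite addrAC subrr add0r normrZ gtr0_norm// ler_piMr// ltW.
by apply: osc; exact: sub.
Qed.

Lemma hessian_holder : exists alpha : R, 0 < alpha < 1 /\
  forall c r w u H A, 0 < r -> 0 < w -> ek_data lam Lam c r u H A ->
  (forall x y i j, `|x - c| <= r -> `|y - c| <= r -> `|H x i j - H y i j| <= w) ->
  forall x i j, `|x - c| <= r ->
    `|H x i j - H c i j| <= 2 * w * (`|x - c| / r) `^ alpha.
Proof.
have [th [/andP[th0 th2] half]] := oscillation_halves.
have ln2 : 0 < ln (2 : R) by rewrite ln_gt0// ltr1n.
have lnth : ln th <= - ln 2.
  by rewrite -lnV ?posrE// ler_ln ?posrE// invr_gt0.
(* Half of the exponent at which the power of [th] equals [1/2], so that [al < 1] even for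
   [th = 1/2]. *)
pose al := ln 2 / (- 2 * ln th).
have den : 0 < - 2 * ln th by lra.
have al0 : 0 < al by rewrite divr_gt0.
have al1 : al < 1 by rewrite ltr_pdivrMr// mul1r; lra.
have thal : 2^-1 <= th `^ al.
  rewrite /powR gt_eqF// -[leLHS]lnK ?posrE ?invr_gt0// ler_expR lnV ?posrE//.
  have -> : al * ln th = - (ln 2 / 2).
    by rewrite /al; field; rewrite lt_eqF//; lra.
  lra.
exists al; split; first by rewrite al0.
move=> c r w u H A r0 w0 ek osc.
have th1 : th <= 1 by lra.
have oscK k x y i j : `|x - c| <= th ^+ k * r -> `|y - c| <= th ^+ k * r ->
    `|H x i j - H y i j| <= w / 2 ^+ k.
  elim: k x y i j => [|k IH] x y i j.
    by rewrite expr0 mul1r invr1 mulr1; exact: osc.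
  rewrite exprS -mulrA => xk yk.
  have -> : w / 2 ^+ k.+1 = w / 2 ^+ k / 2 by rewrite exprS invfM; ring.
  have rk : 0 < th ^+ k * r by rewrite mulr_gt0// exprn_gt0.
  have ekk : ek_data lam Lam c (th ^+ k * r) u H A.
    apply: ek_data_sub ek; rewrite subrr normr0 add0r.
    by rewrite ler_piMl ?(ltW r0)// exprn_ile1// ltW.
  apply: (half c (th ^+ k * r) _ u H A) => //.
  by rewrite divr_gt0// exprn_gt0.
move=> x i j xr.
have [->|xc] := eqVneq x c.
  by rewrite subrr normr0 mulr_ge0 ?powR_ge0// mulr_ge0// ltW.
set d := `|x - c| / r.
have xc0 : 0 < `|x - c| by rewrite normr_gt0 subr_eq0.
have d0 : 0 < d by rewrite divr_gt0.
have d1 : d <= 1 by rewrite ler_pdivrMr// mul1r.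
(* The oscillation bound is used at the power of [th] preceding the first one below [d]; the factor
   2 in the statement pays for the missing halving. *)
have ex : exists k, th ^+ k < d.
  have [|k] := @geometric_small R (1 - th) d _ d0; first by apply/andP; split; lra.
  by rewrite opprB addrC subrK; exists k.
case: (ex_minnP ex) => -[|k] kd kmin; first by move: kd; rewrite expr0 ltNge d1.
have dk : d <= th ^+ k by rewrite leNgt; apply/negP => /kmin; rewrite ltnn.
have xk : `|x - c| <= th ^+ k * r by rewrite -ler_pdivrMr.
have ck : `|c - c| <= th ^+ k * r by rewrite subrr normr0 mulr_ge0 ?exprn_ge0// ltW.
apply: le_trans (oscK k _ _ i j xk ck) _.
have -> : w / 2 ^+ k = 2 * w * (2^-1) ^+ k.+1.
  by rewrite exprS exprVn; field; rewrite expf_neq0.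
rewrite ler_wpM2l ?mulr_ge0 ?(ltW w0)//.
apply: le_trans (_ : (th `^ al) ^+ k.+1 <= _).
  by rewrite lerXn2r ?nnegrE ?powR_ge0 ?invr_ge0.
rewrite -powR_mulrn ?powR_ge0// -powRrM mulrC powRrM powR_mulrn ?(ltW th0)//.
by apply: ge0_ler_powR; rewrite ?nnegrE ?exprn_ge0 ?(ltW al0) ?(ltW th0) ?(ltW d0) ?(ltW kd).
Qed.

End OscillationDecay.


(** * Calculus along segments *)

Section Calculus.
Variables (R : realType) (p q : nat).
Implicit Types (f : 'M[R]_(p, q) -> R) (x z : 'M[R]_(p, q)).

Lemma is_derive_line f x z (t : R) : differentiable f (x + t *: z) ->
  is_derive t (1 : R) (fun s : R => f (x + s *: z)) ('D_z f (x + t *: z)).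
Proof.
move=> df.
have E : (fun h : R => h^-1 *: (f (x + (h *: (1 : R) + t) *: z) - f (x + t *: z)))
    = (fun h : R => h^-1 *: (f (h *: z + (x + t *: z)) - f (x + t *: z))).
  apply/funext => h; congr (_ *: (f _ - _)).
  by rewrite scalerDl addrCA -[h *: 1]/(h * 1) mulr1.
have := @diff_derivable _ _ _ f _ z df; rewrite /derivable /comp /= -E => der.
by apply: (DeriveDef der); rewrite /derive /comp /= -E.
Qed.

Lemma mvt_line f x z (a b : R) : a < b ->
  (forall t, a <= t <= b -> differentiable f (x + t *: z)) ->
  exists2 s, a < s < b &
    f (x + b *: z) - f (x + a *: z) = 'D_z f (x + s *: z) * (b - a).
Proof.
move=> ab df.
have [||s] := @MVT R (fun s => f (x + s *: z)) (fun s => 'D_z f (x + s *: z)) a b ab.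
- move=> s; rewrite in_itv /= => /andP[s1 s2]; apply: is_derive_line.
  by apply: df; rewrite !ltW.
- apply: derivable_within_continuous => s; rewrite in_itv /= => sab.
  by case: (is_derive_line (df s sab)).
- by rewrite in_itv /= => sab E; exists s.
Qed.

Lemma derive_sum_pd f x z : differentiable f x ->
  'D_z f x = \sum_i \sum_j z i j * pd f i j x.
Proof.
move=> df; rewrite deriveE// {1}(matrix_sum_delta z) raddf_sum /=.
apply: eq_bigr => i _; rewrite raddf_sum /=; apply: eq_bigr => j _.
by rewrite linearZ /= /pd deriveE.
Qed.

Lemma continuous_dist f x : {for x, continuous f} -> forall e, 0 < e ->
  exists d : R, 0 < d /\ forall y, `|y - x| < d -> `|f y - f x| < e.
Proof.
move=> /cvgrPdist_lt cf e e0; have /nbhs_mxP[d [d0 H]] := cf e e0.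
by exists d; split=> // y yx; rewrite distrC; apply: H; rewrite distrC.
Qed.

End Calculus.

Lemma common_radius (R : realType) (I : finType) (P : I -> R -> Prop) :
  (forall i d d', d' <= d -> P i d -> P i d') ->
  (forall i, exists d, 0 < d /\ P i d) -> exists d, 0 < d /\ forall i, P i d.
Proof.
move=> anti ex; have /choice[d Hd] := ex.
exists (\big[Num.min/1]_i d i); split.
  by apply: (big_ind (fun d : R => 0 < d)) => // [a b a0 b0|i _]; [rewrite lt_min a0|case: (Hd i)].
move=> i; apply: anti (Hd i).2; exact: bigmin_le_cond.
Qed.

(** * Symmetry of the Hessian and second-order expansion *)

Section SecondOrder.
Variables (R : realType) (n : nat) (u : 'rV[R]_n -> R).
Implicit Types (x z : 'rV[R]_n).
Hypothesis u_C2 : C2_on (eball 1) u.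

Lemma eballE (r : R) x : 0 < r -> eball r x <-> enorm2 x < r ^+ 2.
Proof.
move=> r0; rewrite /eball /= /enorm.
by rewrite -(@ltr_pXn2r _ 2) ?nnegrE ?sqrtr_ge0 ?(ltW r0)// sqr_sqrtr ?enorm2_ge0.
Qed.

Lemma eball_open : open (@eball R n 1).
Proof.
have -> : @eball R n 1 = @enorm2 R n @^-1` [set y | y < 1].
  by apply/seteqP; split=> x /=; rewrite (eballE _ ltr01) expr1n.
by apply: open_comp; [move=> x _; exact: enorm2_continuous|exact: open_lt].
Qed.

Lemma u_diff x : eball 1 x -> differentiable u x.
Proof. by case: u_C2 => H _ _; exact: H. Qed.

Lemma du_diff i x : eball 1 x -> differentiable (du u i) x.
Proof. by case: u_C2 => _ H _; exact: H. Qed.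

Lemma ddu_continuous i j x : eball 1 x -> {for x, continuous (ddu u i j)}.
Proof.
move=> x1; case: u_C2 => _ _ /(_ ord0 j ord0 i).
by rewrite continuous_open_subspace; [apply; rewrite inE|exact: eball_open].
Qed.

Lemma derive_du x z : eball 1 x -> 'D_z u x = \sum_i z ord0 i * du u i x.
Proof. by move=> x1; rewrite derive_sum_pd ?big_ord1//; exact: u_diff. Qed.

Lemma derive_ddu j x z : eball 1 x ->
  'D_z (du u j) x = \sum_i z ord0 i * ddu u i j x.
Proof. by move=> x1; rewrite derive_sum_pd ?big_ord1//; exact: du_diff. Qed.

(** The mean value theorem in direction [i] for the increment of [u] in direction [j], then in
    direction [j] for [du u i]. *)
Lemma mixed_difference i j x (h : R) : 0 < h ->
  (forall s t, 0 <= s <= h -> 0 <= t <= h ->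
     eball 1 (x + s *: delta_mx ord0 i + t *: delta_mx ord0 j)) ->
  exists s t, [/\ 0 <= s <= h, 0 <= t <= h &
   u (x + h *: delta_mx ord0 i + h *: delta_mx ord0 j)
   - u (x + h *: delta_mx ord0 i) - u (x + h *: delta_mx ord0 j) + u x
   = ddu u j i (x + s *: delta_mx ord0 i + t *: delta_mx ord0 j) * h ^+ 2].
Proof.
move=> h0 inU; set ei := delta_mx ord0 i; set ej := delta_mx ord0 j.
have h0h : 0 <= h <= h by apply/andP; split=> //; exact: ltW.
have z0h : (0 : R) <= 0 <= h by apply/andP; split=> //; exact: ltW.
have U0 s : 0 <= s <= h -> eball 1 (x + s *: ei).
  by move=> sh; have := inU s 0 sh z0h; rewrite scale0r addr0.
have Uh s : 0 <= s <= h -> eball 1 (x + h *: ej + s *: ei).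
  by move=> sh; rewrite addrAC; exact: inU.
pose g (s : R) := u (x + h *: ej + s *: ei) - u (x + s *: ei).
have dg s : 0 <= s <= h -> is_derive s (1 : R) g
    ('D_ei u (x + h *: ej + s *: ei) - 'D_ei u (x + s *: ei)).
  move=> sh; have d1 := is_derive_line (u_diff (Uh s sh)).
  have d2 := is_derive_line (u_diff (U0 s sh)).
  exact: (is_deriveB d1 d2).
have [||s] := @MVT R g (fun s => 'D_ei u (x + h *: ej + s *: ei)
    - 'D_ei u (x + s *: ei)) 0 h h0.
- by move=> s; rewrite in_itv /= => /andP[s0 sh]; apply: dg; rewrite !ltW.
- apply: derivable_within_continuous => s; rewrite in_itv /= => sh.
  by case: (dg s sh).
rewrite in_itv /= subr0 => /andP[s0 sh].
have ss : 0 <= s <= h by rewrite !ltW.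
have -> : 'D_ei u (x + h *: ej + s *: ei) - 'D_ei u (x + s *: ei)
  = du u i (x + s *: ei + h *: ej) - du u i (x + s *: ei) by rewrite addrAC.
have [|t /andP[t0' th]] := @mvt_line _ _ _ (du u i) (x + s *: ei) ej 0 h h0.
  by move=> t th; apply: du_diff; exact: inU.
rewrite scale0r addr0 subr0 => -> E; exists s, t; split=> //; first by rewrite !ltW.
move: E; rewrite /g !scale0r !addr0 (addrAC x (h *: ej)) => E.
have -> : ddu u j i (x + s *: ei + t *: ej) = 'D_ej (du u i) (x + s *: ei + t *: ej) by [].
by rewrite expr2 mulrA -E; ring.
Qed.

(** The mixed difference is symmetric in the two directions, so [mixed_difference] expresses it by
    either second derivative; continuity lets the step shrink. *)
Lemma ddu_sym i j x : eball 1 x -> ddu u i j x = ddu u j i x.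
Proof.
move=> x1; apply/eqP; rewrite -subr_eq0 -normr_le0; apply/ler_addgt0Pl => e e0.
rewrite addr0; have e2 : 0 < e / 2 by rewrite divr_gt0.
have /nbhs_mxP[d0 [d00 HU]] : nbhs x (@eball R n 1) by apply: open_nbhs_nbhs; split => //; exact: eball_open.
have [d1 [d10 H1]] := continuous_dist (@ddu_continuous i j x x1) e2.
have [d2 [d20 H2]] := continuous_dist (@ddu_continuous j i x x1) e2.
pose h := Num.min d0 (Num.min d1 d2) / 3.
have h0 : 0 < h by rewrite divr_gt0// !lt_min d00 d10.
have hd : 3 * h <= d0 /\ 3 * h <= d1 /\ 3 * h <= d2.
  have -> : 3 * h = Num.min d0 (Num.min d1 d2) by rewrite /h; field.
  by rewrite !ge_min !lexx !orbT.
have near k l (s t : R) : 0 <= s <= h -> 0 <= t <= h ->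
    `|x + s *: delta_mx ord0 k + t *: delta_mx ord0 l - x| < 3 * h.
  move=> sh th; rewrite -(addrA x) addrAC subrr add0r.
  have dn m (r : R) : 0 <= r <= h -> `|r *: (delta_mx ord0 m : 'rV[R]_n)| <= h.
    move=> /andP[r0 rh]; rewrite normrZ ger0_norm//.
    have : `|delta_mx ord0 m : 'rV[R]_n| <= 1.
      by apply: norm_le_coord => // o; rewrite mxE; case: (_ && _); rewrite ?normr1 ?normr0.
    by move=> /(ler_wpM2l r0); rewrite mulr1; lra.
  by have := ler_normD (s *: (delta_mx ord0 k : 'rV[R]_n)) (t *: delta_mx ord0 l);
    have := dn k s sh; have := dn l t th; lra.
have [hd0 [hd1 hd2]] := hd.
have inU k l s t : 0 <= s <= h -> 0 <= t <= h ->
    eball 1 (x + s *: delta_mx ord0 k + t *: delta_mx ord0 l).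
  by move=> sh th; apply: HU; rewrite distrC; apply: lt_le_trans (near k l s t sh th) _.
have [s [t [sh th E]]] := mixed_difference h0 (inU i j).
have [s' [t' [sh' th' E']]] := mixed_difference h0 (inU j i).
have EE : ddu u j i (x + s *: delta_mx ord0 i + t *: delta_mx ord0 j)
   = ddu u i j (x + s' *: delta_mx ord0 j + t' *: delta_mx ord0 i).
  have h2 : h ^+ 2 != 0 by rewrite expf_neq0// lt0r_neq0.
  move: E'; rewrite (addrAC x (h *: delta_mx ord0 j) (h *: delta_mx ord0 i)).
  by rewrite [X in X + _ = _ -> _]addrAC E => /(mulIf h2).
have A1 := H1 _ (lt_le_trans (near j i s' t' sh' th') hd1).
have A2 := H2 _ (lt_le_trans (near i j s t sh th) hd2).
rewrite -EE in A1; move: A1 A2.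
move: (ddu u j i (_ + _)) (ddu u i j x) (ddu u j i x) => a b c A1 A2.
have -> : b - c = (a - c) - (a - b) by ring.
apply: le_trans (ler_normB _ _) _; move: A1 A2; clear; lra.
Qed.

Lemma hessE i j x : hess u x i j = ddu u i j x.
Proof. by rewrite mxE. Qed.

Lemma hess_sym x : eball 1 x -> (hess u x)^T = hess u x.
Proof. by move=> x1; apply/matrixP => i j; rewrite !mxE ddu_sym. Qed.

(** The mean value theorem is applied to the even part of [u] along the segment with its quadratic
    model removed, then to the directional derivative on a symmetric interval. *)
Lemma second_difference_hess x z (a : R) :
  (forall t, `|t| <= 1 -> eball 1 (x + t *: z)) ->
  (forall t i j, `|t| <= 1 -> `|hess u (x + t *: z) i j - hess u x i j| <= a) ->
  `|sd u x z - qf (hess u x) z| <= 2 * a * n%:R * enorm2 z.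
Proof.
move=> seg osc; pose Q := qf (hess u x) z.
have a0 : 0 <= a * n%:R * enorm2 z.
  rewrite mulr_ge0 ?enorm2_ge0//; have [->|n0] := posnP n; first by rewrite mulr0.
  rewrite mulr_ge0//.
  by apply: le_trans (osc 0 (Ordinal n0) (Ordinal n0) _); rewrite ?normr0.
have D2 t : `|t| <= 1 -> `|qf (hess u (x + t *: z)) z - Q| <= a * n%:R * enorm2 z.
  move=> t1; rewrite -qfB; apply: qf_le_entries => i j.
  by rewrite mxE [X in _ + X]mxE; exact: osc.
pose G (y : 'rV[R]_n) := \sum_i z ord0 i * du u i y.
have dG y : eball 1 y -> differentiable G y.
  move=> y1; have -> : G = \sum_i (fun y => z ord0 i * du u i y).
    by apply/funext => w; rewrite fct_sumE.
  apply: differentiable_sum => i; apply: differentiableM => //; exact: du_diff.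
have DG y : eball 1 y -> 'D_z G y = qf (hess u y) z.
  move=> y1; have -> : G = \sum_i (fun y => z ord0 i * du u i y).
    by apply/funext => w; rewrite fct_sumE.
  rewrite derive_sum => [|i]; last first.
    by apply: diff_derivable; apply: differentiableM => //; exact: du_diff.
  rewrite /qf exchange_big /=; apply: eq_bigr => j _.
  have -> : 'D_z (fun y => z ord0 j * du u j y) y = z ord0 j * 'D_z (du u j) y.
    have := @deriveMl _ _ (du u j) (z ord0 j) y z; apply.
    by apply: diff_derivable; exact: du_diff.
  rewrite derive_ddu// mulr_sumr; apply: eq_bigr => i _; rewrite hessE; ring.
have segR (t : R) : 0 <= t <= 1 -> eball 1 (x + t *: z) /\ eball 1 (x - t *: z).
  move=> /andP[t0 t1]; rewrite -scaleNr; split; apply: seg.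
    by rewrite ger0_norm.
  by rewrite normrN ger0_norm.
pose Phi (t : R) := u (x + t *: z) + u (x + t *: (- z)) - t ^+ 2 * Q.
have dPhi (t : R) : 0 <= t <= 1 -> is_derive t (1 : R) Phi
    (G (x + t *: z) - G (x - t *: z) - 2 * t * Q).
  move=> t01; have [sp sm] := segR t t01.
  have d1 := is_derive_line (u_diff sp).
  have sm' : eball 1 (x + t *: (- z)) by rewrite scalerN.
  have d2 := is_derive_line (u_diff sm').
  have d3 : is_derive t (1 : R) (fun t : R => t ^+ 2 * Q) (2 * t * Q).
    have -> : (fun t : R => t ^+ 2 * Q) = (Q \*: (fun t : R => t ^+ 2)).
      by apply/funext => s /=; rewrite mulrC.
    apply: is_derive_eq; rewrite /= -[_ *: _]/(_ * _) -[_ *: _]/(_ * _); ring.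
  have -> : Phi = (fun s : R => u (x + s *: z)) + (fun s : R => u (x + s *: (- z)))
      - (fun t : R => t ^+ 2 * Q) by apply/funext.
  apply: is_derive_eq; congr (_ - _); rewrite !derive_du// scalerN; congr (_ + _).
  by rewrite -sumrN; apply: eq_bigr => i _; rewrite mxE mulNr.
have [||s] := @MVT R Phi (fun t => G (x + t *: z) - G (x - t *: z) - 2 * t * Q) 0 1 ltr01.
- by move=> s; rewrite in_itv /= => /andP[s0 s1]; apply: dPhi; rewrite !ltW.
- by apply: derivable_within_continuous => s; rewrite in_itv /= => /dPhi[].
rewrite in_itv /= => /andP[s0 s1].
have -> : Phi 1 - Phi 0 = sd u x z - Q.
  by rewrite /Phi /sd !scale0r !addr0 !scale1r; ring.
rewrite subr0 mulr1 => ->.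
have [|s' s'b E] := @mvt_line _ _ _ G x z (- s) s ltac:(lra).
  move=> t /andP[t1 t2]; apply: dG; apply: seg; rewrite ler_norml; lra.
rewrite scaleNr in E; rewrite E.
have s'1 : `|s'| <= 1 by rewrite ler_norml; lra.
rewrite DG; last exact: seg.
have -> : qf (hess u (x + s' *: z)) z * (s - - s) - 2 * s * Q
   = 2 * s * (qf (hess u (x + s' *: z)) z - Q) by ring.
rewrite normrM ger0_norm; last by lra.
have -> : 2 * a * n%:R * enorm2 z = 2 * (a * n%:R * enorm2 z) by ring.
apply: ler_pM => //; [lra|lra|exact: D2].
Qed.

End SecondOrder.


(** * From the nonlinear equation to the abstract data *)

Section Assembly.
Variables (R : realType) (n : nat).

(* [N - M] points into the convex set {F >= 0} from its boundary point [M]. *)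
Lemma quasiconcave_normal (F : 'M[R]_n -> R) (M N : 'M[R]_n) :
  C2_on setT (symmetrize F) -> quasiconcave F ->
  symmetric_mx M -> symmetric_mx N -> F M = 0 -> F N = 0 ->
  0 <= \sum_i \sum_j pd (symmetrize F) i j M * (N - M) i j.
Proof.
move=> [dF ddF _] qF Ms Ns FM FN; set G := symmetrize F; pose D := N - M.
pose f := \sum_i \sum_j (fun y => D i j * pd G i j y).
have fE y : f y = \sum_i \sum_j D i j * pd G i j y.
  by rewrite /f fct_sumE; apply: eq_bigr => i _; rewrite fct_sumE.
have DE y : 'D_D G y = f y by rewrite derive_sum_pd//; exact: dF.
have fc : {for M, continuous f}.
  apply: differentiable_continuous; apply: differentiable_sum => i.
  apply: differentiable_sum => j; apply: differentiableM => //; exact: ddF.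
have -> : \sum_i \sum_j pd G i j M * (N - M) i j = f M.
  by rewrite fE; do 2 (apply: eq_bigr => ? _); rewrite mulrC.
(* Otherwise [G] decreases strictly along a short segment from [M] towards [N], where quasiconcavity
   and [F M = F N = 0] keep [F >= 0]. *)
rewrite leNgt; apply/negP => fM.
have [d [d0 Hd]] := continuous_dist fc (ltac:(by rewrite oppr_gt0) : 0 < - f M).
pose t := Num.min 1 (d / (`|D| + 1)).
have dD : 0 < d / (`|D| + 1) by rewrite divr_gt0// ltr_wpDl.
have t0 : 0 < t by rewrite lt_min ltr01.
have t1 : t <= 1 by rewrite ge_min lexx.
have td : t * `|D| <= d by apply: mul_le_of_le_div => //; [exact: ltW|rewrite ge_min lexx orbT].
have [|s /andP[s0 st]] := @mvt_line _ _ _ G M D 0 t t0.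
  by move=> s _; exact: dF.
rewrite scale0r addr0 subr0 DE.
have fneg : f (M + s *: D) < 0.
  have := Hd (M + s *: D); rewrite addrAC subrr add0r normrZ gtr0_norm// => H.
  have : s * `|D| < d.
    have [D0|D0] := eqVneq `|D| 0; first by rewrite D0 mulr0.
    by apply: lt_le_trans td; rewrite ltr_pM2r// lt0r D0/=.
  by move=> /H; rewrite ltr_norml => /andP[_]; rewrite ltrBlDr addNr.
have Gsym (S : 'M[R]_n) : S^T = S -> G S = F S.
  move=> SS; rewrite /G /symmetrize SS; congr F.
  by apply/matrixP => a b; rewrite !mxE; field.
have E : M + t *: D = t *: N + (1 - t) *: M.
  by rewrite /D scalerBr scalerBl scale1r addrCA addrA.
rewrite Gsym; last first.
  by rewrite E raddfD /= !linearZ /= Ns Ms.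
rewrite Gsym// FM subr0 => EE.
have := qF N M Ns Ms t; rewrite (ltW t0) t1 FM FN minxx -E EE => /(_ isT).
by rewrite pmulr_lge0// leNgt fneg.
Qed.

(** An entry exceeding [K] in absolute value would stay so along a short segment inside the open
    ball, against the Lipschitz bound on [du u j]. *)
Lemma hess_le (u : 'rV[R]_n -> R) (K : R) i j (x : 'rV[R]_n) :
  C2_on (eball 1) u -> C11_bound u (cball (3 / 4)) K ->
  enorm2 x < (3 / 4) ^+ 2 -> `|ddu u i j x| <= K.
Proof.
move=> uC2 [_ _ uK] xb; rewrite leNgt; apply/negP => big.
have in1 (y : 'rV[R]_n) : enorm2 y < (3 / 4) ^+ 2 -> eball 1 y.
  by move=> yb; apply/eballE => //; apply: lt_trans yb _; lra.
have cb (y : 'rV[R]_n) : enorm2 y < (3 / 4) ^+ 2 -> cball (3 / 4) y.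
  move=> yb; rewrite /cball /= /enorm -(@ler_pXn2r _ 2) ?nnegrE ?sqrtr_ge0//.
  by rewrite sqr_sqrtr ?enorm2_ge0// ltW.
have e0 : 0 < `|ddu u i j x| - K by rewrite subr_gt0.
have [d [d0 Hd]] := continuous_dist (ddu_continuous uC2 (i := i) (j := j) (in1 _ xb)) e0.
have e1 : 0 < (3 / 4) ^+ 2 - enorm2 x by rewrite subr_gt0.
have [d' [d0' Hd']] := continuous_dist (@enorm2_continuous R n x) e1.
pose h := Num.min d d' / 2.
have h0 : 0 < h by rewrite divr_gt0// lt_min d0.
have hd : h < d /\ h < d'.
  have : Num.min d d' <= d by rewrite ge_min lexx.
  have : Num.min d d' <= d' by rewrite ge_min lexx orbT.
  by move: h0; rewrite /h; move: (Num.min d d') => a a0 a1 a2; split; lra.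
pose e : 'rV[R]_n := delta_mx ord0 i.
have en : `|e| <= 1.
  by apply: norm_le_coord => // o; rewrite mxE; case: (_ && _); rewrite ?normr1 ?normr0.
have dist (t : R) : 0 <= t <= h -> `|x + t *: e - x| <= h.
  move=> /andP[t0 th]; rewrite addrAC subrr add0r normrZ ger0_norm//.
  by apply: le_trans th; rewrite ler_piMr.
have inb (t : R) : 0 <= t <= h -> enorm2 (x + t *: e) < (3 / 4) ^+ 2.
  move=> th; have := Hd' _ (le_lt_trans (dist t th) hd.2).
  by rewrite ltr_norml => /andP[_]; rewrite ltrBlDr subrK.
have [|s /andP[s0 sh]] := @mvt_line _ _ _ (du u j) x e 0 h h0.
  by move=> t th; apply: (du_diff uC2); exact/in1/inb.
have ss : 0 <= s <= h by rewrite !ltW.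
rewrite scale0r addr0 subr0 -[LHS]/(_ - _) => E.
have := uK j (x + h *: e) x; rewrite E.
have -> : enorm (x + h *: e - x) = h.
  rewrite addrAC subrr add0r /enorm enorm2Z enorm2_delta mulr1 sqrtr_sqr.
  by rewrite gtr0_norm.
have hh : 0 <= h <= h by rewrite lexx ltW.
move=> /(_ (cb _ (inb h hh)) (cb _ xb)).
rewrite normrM (gtr0_norm h0) ler_pM2r//.
have := Hd _ (le_lt_trans (dist s ss) hd.1).
rewrite -[ddu u i j (x + s *: e)]/('D_e (du u j) (x + s *: e)).
move: ('D_e (du u j) (x + s *: e)) (ddu u i j x) => a b H1 H2.
have := ler_normD a (b - a); rewrite addrC subrK distrC.
by move: H1 H2; lra.
Qed.

Lemma ek_data_of_C2 (lam Lam : R) (F : 'M[R]_n -> R) (u : 'rV[R]_n -> R)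
    (c : 'rV[R]_n) (r : R) :
  C2_on setT (symmetrize F) -> quasiconcave F -> unif_elliptic lam Lam F ->
  C2_on (eball 1) u -> (forall x, eball 1 x -> F (hess u x) = 0) ->
  (forall x, `|x - c| <= r -> eball 1 x) ->
  ek_data lam Lam c r u (hess u)
    (fun x => \matrix_(i, j) pd (symmetrize F) i j (hess u x)).
Proof.
move=> FC2 qF eF uC2 Fu sub.
have cube := @compact_cube R n c r.
have hc : forall e : R, 0 < e -> exists d : R, 0 < d /\
    forall x y, `|x - c| <= r -> `|y - c| <= r -> `|x - y| <= d ->
    forall i j, `|hess u x i j - hess u y i j| <= e.
  move=> e e0; pose P (ij : 'I_n * 'I_n) (d : R) :=
    forall x y, `|x - c| <= r -> `|y - c| <= r -> `|x - y| <= d ->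
    `|hess u x ij.1 ij.2 - hess u y ij.1 ij.2| <= e.
  have [|[i j]|d [d0 Hd]] := @common_radius R _ P.
  - by move=> ij d d' dd' H x y xr yr xy; apply: H => //; exact: le_trans dd'.
  - have cont x : `|x - c| <= r -> {for x, continuous (ddu u i j)}.
      by move=> /sub; exact: ddu_continuous.
    have [d [d0 Hd]] := compact_ucont cube cont e0; exists d; split=> // x y xr yr xy.
    by rewrite (hessE _ i j x) (hessE _ i j y); exact: Hd.
  - exists d; split=> // x y xr yr xy i j; exact: (Hd (i, j)).
split.
- by apply: compact_ucont cube _ => x /sub x1; apply: differentiable_continuous; exact: u_diff.
- exact: hc.
- move=> e e0; have a0 : 0 < e / (2 * n%:R + 1) by rewrite divr_gt0// ltr_wpDl// mulr_ge0.
  have [d [d0 Hd]] := hc _ a0; exists d; split=> // x z xr pr mr zd.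
  have seg (t : R) : `|t| <= 1 -> `|x + t *: z - c| <= r.
    rewrite ler_norml => /andP[t1 t2].
    (* Convexity of the cube: the point is a convex combination of [x + z] and [x - z]. *)
    have -> : x + t *: z - c = ((1 + t) / 2) *: (x + z - c) + ((1 - t) / 2) *: (x - z - c).
      by apply/rowP => i; rewrite !mxE; field.
    apply: le_trans (ler_normD _ _) _; rewrite !normrZ !ger0_norm; try lra.
    have a1 : 0 <= (1 + t) / 2 by lra.
    have a2 : 0 <= (1 - t) / 2 by lra.
    by have := ler_wpM2l a1 pr; have := ler_wpM2l a2 mr; lra.
  apply: le_trans (second_difference_hess uC2 (a := e / (2 * n%:R + 1)) _ _) _.
  + by move=> t t1; apply: sub; exact: seg.
  + move=> t i j t1; apply: Hd => //; first exact: seg.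
    by rewrite addrAC subrr add0r normrZ; apply: le_trans zd; rewrite ler_piMl.
  + rewrite ler_wpM2r ?enorm2_ge0//.
    have -> : 2 * (e / (2 * n%:R + 1)) * n%:R = e * (2 * n%:R) / (2 * n%:R + 1) by ring.
    rewrite ler_pdivrMr; last by rewrite ltr_wpDl// mulr_ge0.
    by rewrite ler_pM2l// lerDl.
- by move=> x /sub x1; exact: hess_sym.
- move=> x /sub x1 z; have := eF (hess u x) z (hess_sym uC2 x1) => /=.
  have -> // : \sum_i \sum_j pd (symmetrize F) i j (hess u x) * z ord0 i * z ord0 j
    = qf (\matrix_(i, j) pd (symmetrize F) i j (hess u x)) z.
  by do 2 (apply: eq_bigr => ? _); rewrite mxE.
- move=> x y /sub x1 /sub y1.
  have := quasiconcave_normal FC2 qF (hess_sym uC2 x1) (hess_sym uC2 y1) (Fu x x1) (Fu y y1).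
  have -> // : \sum_i \sum_j pd (symmetrize F) i j (hess u x) * (hess u y - hess u x) i j
    = ip (\matrix_(i, j) pd (symmetrize F) i j (hess u x)) (hess u y - hess u x).
  by do 2 (apply: eq_bigr => ? _); rewrite [(\matrix_(_, _) _) _ _]mxE.
Qed.

End Assembly.

Theorem theorem3p1 (R : realType) (n : nat) (lam Lam : R) :
  0 < lam -> lam <= Lam ->
  exists alpha : R, 0 < alpha < 1 /\
  forall K : R, exists C : R,
  forall (F : 'M[R]_n -> R) (u : 'rV[R]_n -> R),
    C2_on setT (symmetrize F) ->
    quasiconcave F ->
    F 0 = 0 ->
    unif_elliptic lam Lam F ->
    C2_on (eball 1) u ->
    (forall x, eball 1 x -> F (hess u x) = 0) ->
    C11_bound u (cball (3 / 4)) K ->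
    C2alpha_bound u (cball (1 / 2)) alpha C.
Proof.
move=> lam0 lamLam; have Lam0 : 0 < Lam := lt_le_trans lam0 lamLam.
have small34 (x : 'rV[R]_n) : cball (1 / 2) x -> cball (3 / 4) x.
  by rewrite /cball /= => x12; apply: le_trans x12 _; lra.
(* In dimension 0 all bounds on derivatives range over an empty index set. *)
have [n0|n_gt0] := posnP n.
  exists 2^-1; split; first by apply/andP; split; lra.
  move=> K; exists K => F u _ _ _ _ _ _ [uK _ _]; subst n.
  by split=> [x /small34| [] | [] | []] //; exact: uK.
have [al [/andP[al0 al1] holder]] := hessian_holder n_gt0 lam0 Lam0.
exists al; split; first by rewrite al0.
(* A cube of half-side [r0] about a point of the half ball has Euclidean radius at most [1/8], so it
   stays in the ball of radius [3/4]. The added 1 makes the oscillation bound [w] positive, and the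
   absolute value covers every real [K]. *)
move=> K; pose r0 : R := (8 * n%:R)^-1; pose w := 2 * `|K| + 1.
exists (`|K| + 2 * w * r0^-1 `^ al) => F u FC2 qF _ eF uC2 Fu uK.
have n1 : 1 <= n%:R :> R by rewrite ler1n.
have n0 : 0 < n%:R :> R by rewrite ltr0n.
have r00 : 0 < r0 by rewrite invr_gt0 mulr_gt0.
have w0 : 0 < w by rewrite ltr_wpDl// mulr_ge0.
have KK : K <= `|K| := ler_norm K.
have extra : 0 <= 2 * w * r0^-1 `^ al by rewrite mulr_ge0 ?powR_ge0// mulr_ge0// ltW.
have CK : K <= `|K| + 2 * w * r0^-1 `^ al by lra.
have c12 (x : 'rV[R]_n) : cball (1 / 2) x -> enorm2 x <= 4^-1.
  rewrite /cball /= /enorm -(@ler_pXn2r _ 2) ?nnegrE ?sqrtr_ge0//.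
  rewrite sqr_sqrtr ?enorm2_ge0// => H; apply: le_trans H _; lra.
have cube (x y : 'rV[R]_n) : cball (1 / 2) x -> `|y - x| <= r0 -> enorm2 y < (3 / 4) ^+ 2.
  move=> /c12 x12 yx.
  have E : enorm2 (y - x) <= 64^-1.
    apply: le_trans (enorm2_le_norm _) _.
    have : `|y - x| ^+ 2 <= r0 ^+ 2 by rewrite lerXn2r ?nnegrE// ltW.
    move=> /(ler_wpM2l (ltW n0)) /le_trans; apply.
    have -> : n%:R * r0 ^+ 2 = 64^-1 / n%:R by rewrite /r0; field; exact: lt0r_neq0.
    by rewrite ler_pdivrMr// ler_peMr.
  rewrite -(subrK x y) addrC; move: (y - x) E => d E.
  (* Young's inequality for the cross term, weighted to keep the sum below [9/16]. *)
  have := enorm2_ge0 (x - 4 *: d); rewrite !enorm2D enorm2N enorm2Z dotNr dotZr.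
  lra.
have hK x i j : enorm2 x < (3 / 4) ^+ 2 -> `|ddu u i j x| <= K by exact: hess_le.
have in12 (x : 'rV[R]_n) : cball (1 / 2) x -> enorm2 x < (3 / 4) ^+ 2.
  by move=> x12; apply: (cube x) => //; rewrite subrr normr0 ltW.
have [u0 u1 _] := uK.
split=> [x /small34 x34|i x /small34 x34|i j x x12|i j x y x12 y12].
- exact: le_trans (u0 x x34) CK.
- exact: le_trans (u1 i x x34) CK.
- exact: le_trans (hK x i j (in12 x x12)) CK.
have powE : 2 * w * (enorm (x - y) / r0) `^ al
    = 2 * w * r0^-1 `^ al * enorm (x - y) `^ al.
  by rewrite powRM ?invr_ge0 ?sqrtr_ge0 ?(ltW r00)//; ring.
apply: le_trans (_ : 2 * w * (enorm (x - y) / r0) `^ al <= _); last first.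
  by rewrite powE ler_wpM2r ?powR_ge0// lerDr.
have sup_le : `|x - y| <= enorm (x - y).
  rewrite -(@ler_pXn2r _ 2) ?nnegrE ?sqrtr_ge0// sqr_sqrtr ?enorm2_ge0//.
  exact: norm_sqr_le_enorm2.
have osc a b k l : enorm2 a < (3 / 4) ^+ 2 -> enorm2 b < (3 / 4) ^+ 2 ->
    `|hess u a k l - hess u b k l| <= w.
  move=> a34 b34; rewrite (hessE _ k l a) (hessE _ k l b).
  apply: le_trans (ler_normB _ _) _.
  have := hK a k l a34; have := hK b k l b34.
  have aux (s t : R) : `|t| <= K -> `|s| <= K -> `|s| + `|t| <= w.
    by move: KK; rewrite /w; clear; lra.
  by move=> bK aK; exact: aux.
rewrite -!hessE.
(* For distant points the total oscillation [w] suffices, as the power is then at least 1; for near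
   ones the cube centred at [y] contains [x]. *)
have [near|far] := leP `|x - y| r0; last first.
  apply: le_trans (osc _ _ _ _ (in12 x x12) (in12 y y12)) _.
  have one : 1 <= (enorm (x - y) / r0) `^ al.
    rewrite -(powRr0 (enorm (x - y) / r0)); apply: ler_powR; last exact: ltW.
    by rewrite ler_pdivlMr// mul1r; apply: le_trans sup_le; exact: ltW.
  have w2 : 0 <= 2 * w by rewrite mulr_ge0// ltW.
  by have := ler_wpM2l w2 one; rewrite mulr1; lra.
have ek : ek_data lam Lam y r0 u (hess u)
    (fun x => \matrix_(i, j) pd (symmetrize F) i j (hess u x)).
  apply: ek_data_of_C2 => // z zy; apply/eballE => //.
  by apply: lt_trans (cube y z y12 zy) _; lra.
apply: le_trans (holder y r0 w u _ _ r00 w0 ek _ x i j near) _.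
  by move=> a b k l ay by_; apply: osc; exact: (cube y).
rewrite ler_wpM2l ?mulr_ge0 ?(ltW w0)//.
apply: ge0_ler_powR.
- exact: ltW.
- by rewrite nnegrE divr_ge0// ltW.
- by rewrite nnegrE divr_ge0 ?sqrtr_ge0// ltW.
- by rewrite ler_pM2r// invr_gt0.
Qed.
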